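(* Let $(\Gamma_1,\prec_1)$ and $(\Gamma_2,\prec_2)$ be planar graphs with $|Out(\Gamma_1)|=|In(\Gamma_2)|$. Then their composition $(\Gamma_2\circ\Gamma_1,\prec)$ is a planar graph.
   Context: A graph is a triple $(H,P,\sigma)$ with $H$ a finite set (half-edges), $P$ a partition of $H$ into nonempty blocks (vertices), $\sigma$ an involution of $H$ (its orbits are the edges), such that a vertex containing a two-element $\sigma$-orbit equals that orbit; such vertices and edges are called virtual, all other vertices real. A leg is a half-edge fixed by $\sigma$ (real leg) or lying in a virtual edge (virtual leg). An orientation $\mathrm{sgn}:H\to\{+,-\}$ takes different values on the two elements of each two-element orbit; $In(v),Out(v)$ (resp. $In(\Gamma),Out(\Gamma)$) are the sets of half-edges in $v$ (resp. of legs) of sign $+$, $-$. The graph is directed if all $In(v),Out(v)$ are nonempty. The source (target) of an edge is the vertex containing its $-$ ($+$) half-edge, if there is one; $e\to e'$ means there are edges $e=e_1,\dots,e_n=e'$, $n\ge 1$, with the target of $e_i$ equal to the source of $e_{i+1}$. A planar graph is a directed graph with a linear order $\prec$ on its set of edges such that for all distinct edges: $(P_1)$ $e_1\to e_2$ implies $e_1\prec e_2$; $(P_2)$ if $e_1\to e_2$ and $e_1\prec e_3\prec e_2$ then $e_1\to e_3$ or $e_3\to e_2$. $In(\Gamma)$ and $Out(\Gamma)$ are ordered by $\prec$ applied to the edges containing the legs. Composition: let $Out(\Gamma_1)=\{o_1,\dots,o_n\}$ and $In(\Gamma_2)=\{i_1,\dots,i_n\}$ in increasing order. $\Gamma_2\circ\Gamma_1$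 is obtained from the disjoint union (with the inherited orientation) by grafting $o_k$ to $i_k$ for each $k$: if both are real legs, join them into an edge $\bar e_k=\{o_k,i_k\}$; if exactly one is virtual, delete its virtual edge, the edge of the other being $\bar e_k$; if both are virtual, delete $o_k,i_k$ and let $\bar e_k=\{\sigma_1(o_k),\sigma_2(i_k)\}$ be a virtual edge (and a virtual vertex). The order $\prec$ on edges is $A_1,\bar e_1,B_1,\dots,A_n,\bar e_n,B_n$, where $A_k$ is the set of edges of $\Gamma_1$ strictly between the edges of $o_{k-1}$ and $o_k$ (before that of $o_1$ if $k=1$) and $B_k$ the set of edges of $\Gamma_2$ strictly between the edges of $i_k$ and $i_{k+1}$ (after that of $i_n$ if $k=n$), each with its own order. (No edge of $\Gamma_1$ lies after that of $o_n$ and no edge of $\Gamma_2$ lies before that of $i_1$.) *)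

(* Defs.v *)
From mathcomp Require Import all_boot.

Set Implicit Arguments.
Unset Strict Implicit.
Unset Printing Implicit Defensive.

(* Raw data (H, P, sigma, sgn, prec); all axioms are in the predicates below.
   [sgn h = true] encodes the sign +.  [prec] is only meaningful on edges. *)
Record graph_data := GraphData {
  half :> finType;
  vert : {set {set half}};
  sigma : half -> half;
  sgn : half -> bool;
  prec : rel {set half}
}.

Section Graph.
Variable G : graph_data.
Implicit Types (h : G) (v e : {set G}).

Definition edge h : {set G} := [set h; sigma h].

Definition edges : {set {set G}} := [set edge h | h : G].

Definition is_graph : Prop :=
  [/\ partition (vert G) [set: G],
      involutive (@sigma G) &
      forall v h, v \in vert G -> sigma h != h -> edge h \subset v ->
        v = edge h].

Definition in_virtual_edge h : bool := (sigma h != h) && (edge h \in vert G).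

Definition leg h : bool := (sigma h == h) || in_virtual_edge h.

Definition is_orientation : Prop :=
  forall h, sigma h != h -> sgn (sigma h) != sgn h.

Definition In_v v : {set G} := [set h in v | sgn h].
Definition Out_v v : {set G} := [set h in v | ~~ sgn h].
Definition In_G : {set G} := [set h | leg h & sgn h].
Definition Out_G : {set G} := [set h | leg h & ~~ sgn h].

Definition directed : Prop :=
  forall v, v \in vert G -> In_v v != set0 /\ Out_v v != set0.

Definition is_source v e : bool := (v \in vert G) && (Out_v v :&: e != set0).
Definition is_target v e : bool := (v \in vert G) && (In_v v :&: e != set0).

Definition edge_step : rel {set G} := fun e e' =>
  [&& e \in edges, e' \in edges & [exists v, is_target v e && is_source v e']].

(* [reach e e'] is e -> e'; it is reflexive (the case n = 1). *)
Definition reach : rel {set G} := connect edge_step.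

Definition is_linear_order : Prop :=
  [/\ {in edges, forall e, ~~ prec e e},
      {in edges & &, transitive (@prec G)} &
      {in edges &, forall e e', [|| e == e', prec e e' | prec e' e]}].

Definition axiom_P1 : Prop :=
  {in edges &, forall e1 e2, e1 != e2 -> reach e1 e2 -> prec e1 e2}.

Definition axiom_P2 : Prop :=
  {in edges & &, forall e1 e2 e3, uniq [:: e1; e2; e3] ->
     reach e1 e2 -> prec e1 e3 -> prec e3 e2 -> reach e1 e3 \/ reach e3 e2}.

Definition planar : Prop :=
  [/\ is_graph, is_orientation & directed] /\ [/\ is_linear_order, axiom_P1 & axiom_P2].

Definition preceq : rel {set G} := fun e e' => (e == e') || prec e e'.

Definition edge_seq : seq {set G} := sort preceq (enum edges).

Definition sort_legs (A : {set G}) : seq G :=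
  sort (fun h h' => preceq (edge h) (edge h')) (enum A).

Definition ins : seq G := sort_legs In_G.
Definition outs : seq G := sort_legs Out_G.

End Graph.

(* Composition of G2 after G1.  It is defined for arbitrary data, but it is
   meaningful only when G1, G2 are planar and #|Out_G G1| = #|In_G G2|. *)
Section Composition.
Variables G1 G2 : graph_data.

Notation sumH := (G1 + G2)%type.

(* The pairs (o_k, i_k), in increasing order of k (counted from 0). *)
Definition grafts : seq (G1 * G2) := zip (outs G1) (ins G2).

Definition inl_set (A : {set G1}) : {set sumH} := [set inl h | h in A].
Definition inr_set (A : {set G2}) : {set sumH} := [set inr h | h in A].

(* The half-edges deleted when grafting o to i. *)
Definition graft_del (p : G1 * G2) : {set sumH} :=
  let: (o, i) := p in
  match in_virtual_edge o, in_virtual_edge i with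
  | false, false => set0
  | true, false => inl_set (edge o)
  | false, true => inr_set (edge i)
  | true, true => [set inl o; inr i]
  end.

(* The edge \bar e resulting from grafting o to i. *)
Definition graft_edge (p : G1 * G2) : {set sumH} :=
  let: (o, i) := p in
  match in_virtual_edge o, in_virtual_edge i with
  | false, false => [set inl o; inr i]
  | true, false => inr_set (edge i)
  | false, true => inl_set (edge o)
  | true, true => [set inl (sigma o); inr (sigma i)]
  end.

Definition deleted : {set sumH} := \bigcup_(p in grafts) graft_del p.

Definition comp_half : finType := {x : sumH | x \notin deleted}.

Definition restr (A : {set sumH}) : {set comp_half} := [set x | val x \in A].

(* A vertex of G1 or G2 meeting [deleted] is virtual: either it is deleted
   entirely, or its remaining half-edge goes to the virtual vertex \bar e. *)
Definition comp_vert : {set {set comp_half}} :=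
  [set restr (inl_set v) | v in vert G1 & [disjoint inl_set v & deleted]]
  :|: [set restr (inr_set v) | v in vert G2 & [disjoint inr_set v & deleted]]
  :|: [set restr (graft_edge p) | p in grafts &
         in_virtual_edge p.1 && in_virtual_edge p.2].

(* The other element of the edge \bar e containing x (x itself if \bar e is
   a singleton), or the inherited value if x lies in no \bar e. *)
Definition sum_sigma (x : sumH) : sumH :=
  if [pick p in grafts | x \in graft_edge p] is Some p then
    odflt x [pick y in graft_edge p | y != x]
  else match x with inl h => inl (sigma h) | inr h => inr (sigma h) end.

(* The default value x of [insubd] is not used for planar G1, G2, as
   [sum_sigma] then preserves the complement of [deleted]. *)
Definition comp_sigma (x : comp_half) : comp_half :=
  insubd x (sum_sigma (val x)).

Definition comp_sgn (x : comp_half) : bool :=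
  match val x with inl h => sgn h | inr h => sgn h end.

Definition out_edges : seq {set G1} := [seq edge o | o <- outs G1].
Definition in_edges : seq {set G2} := [seq edge i | i <- ins G2].

(* A_(k+1) and B_(k+1), listed in increasing order. *)
Definition seqA (k : nat) : seq {set G1} :=
  [seq a <- edge_seq G1 |
    ((k == 0) || prec (nth set0 out_edges k.-1) a)
    && prec a (nth set0 out_edges k)].
Definition seqB (k : nat) : seq {set G2} :=
  [seq b <- edge_seq G2 |
    prec (nth set0 in_edges k) b
    && ((k.+1 == size in_edges) || prec b (nth set0 in_edges k.+1))].

(* The list A_1, \bar e_1, B_1, ..., A_n, \bar e_n, B_n. *)
Definition comp_edge_seq : seq {set comp_half} :=
  flatten [seq [seq restr (inl_set a) | a <- seqA k]
            ++ nth set0 [seq restr (graft_edge p) | p <- grafts] k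
            :: [seq restr (inr_set b) | b <- seqB k]
          | k <- iota 0 (size grafts)].

Definition comp_prec : rel {set comp_half} := fun e e' =>
  (e' \in comp_edge_seq) && (index e comp_edge_seq < index e' comp_edge_seq).

End Composition.

Definition graph_comp (G2 G1 : graph_data) : graph_data :=
  @GraphData (comp_half G1 G2) (@comp_vert G1 G2) (@comp_sigma G1 G2)
    (@comp_sgn G1 G2) (@comp_prec G1 G2).

(* Main.v *)
Require Import Defs.
From mathcomp Require Import all_boot.

(** The edges of the composition are those of the two graphs, with the edge of
   the k-th outgoing leg o_k of G1 identified with the edge of the k-th incoming
   leg i_k of G2; call it the k-th graft.  Everything rests on what legs look
   like in one planar graph.  Nothing leaves an outgoing leg [out_leg_reach];
   every edge reaches an outgoing leg [reach_out_leg], because each vertex has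
   an outgoing half-edge and (P1) excludes infinite paths; and (P2) improves
   this to: an edge that precedes an outgoing leg o reaches some outgoing leg at
   or before o [reach_out_leg_before].  Incoming legs satisfy the dual facts in
   the opposite graph.

   Hence a path of the composition stays in one graph or passes once from G1 to
   G2, and then through a graft [creach_cases].  The order of the composition
   restricts to the given orders on both graphs [glued_mono], and when an edge a of
   G1 precedes an edge b of G2, some graft k satisfies a <= o_k and i_k <= b
   [glued12_cprec].  These statements give (P1) at once.

   For (P2), let e1 -> e2 and e1 < e3 < e2.  If the three edges come from one
   graph, (P2) holds there.  If e1 and e2 come from G1 and e3 from G2, a graft
   separates e1 from e3, and by the improved reachability, applied in the
   opposite of G2, it may be chosen so that i_k -> e3; since o_k lies between e1
   and e2 and nothing leaves o_k, (P2) in G1 gives e1 -> o_k, hence e1 -> e3.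
   If e1 -> o_k and i_k -> e2, the edge e3 is compared with the graft k: if it
   lies between e1 and o_k then (P2) of G1 concludes, and if it is an edge of G1
   after o_k then e3 -> o_l for some graft l with i_l at or before e2; as i_l
   comes after i_k, (P2) in G2 gives i_l -> e2.  The remaining cases are dual.

   To treat dual cases once, G2 is replaced by its opposite, so that composition
   glues outgoing legs of two planar graphs; statements then carry a boolean
   [b] that selects one of the two sides. *)

Set Implicit Arguments.
Unset Strict Implicit.
Unset Printing Implicit Defensive.

(** * Pairs and positions in lists *)

Lemma pair_other (T : finType) (u v x : T) : x \in [set u; v] ->
  [set x; odflt x [pick y in [set u; v] | y != x]] = [set u; v].
Proof.
move=> xuv; case: pickP => [y /andP[yuv yx]|none] /=.
  move: xuv yuv yx; rewrite !inE => /orP[]/eqP-> /orP[]/eqP->; rewrite ?eqxx //.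
  by rewrite setUC.
have eq_x y : y \in [set u; v] -> y = x.
  by move=> yuv; have := none y; rewrite yuv /= => /eqP.
have [ux vx] : u = x /\ v = x by split; apply: eq_x; rewrite !inE eqxx ?orbT.
by rewrite [in RHS]ux [in RHS]vx.
Qed.

(** Comparing positions in a sorted list needs only the failure of the reverse
   comparison, since positions are totally ordered. *)
Lemma index_map_pairwise (T T' : eqType) (f : T -> T') (r : rel T) s x y :
  {in s &, injective f} -> pairwise r s -> x \in s -> y \in s -> ~~ r y x -> x != y ->
  index (f x) (map f s) < index (f y) (map f s).
Proof.
move=> injf /(pairwiseP x) pr xs ys nyx neq; rewrite ltnNge; apply/negP.
have ltx : index (f x) (map f s) < size s by rewrite -(size_map f) index_mem map_f.
have lty : index (f y) (map f s) < size s by rewrite -(size_map f) index_mem map_f.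
rewrite leq_eqVlt => /predU1P[e|lt].
  by case/eqP: neq; rewrite -(nth_index_map x injf xs) -e nth_index_map.
by case/negP: nyx; have := pr _ _ lty ltx lt; rewrite !nth_index_map.
Qed.

(** * Edges and paths of a planar graph *)

Section Edges.
Variable G : graph_data.
Hypothesis sigmaK : involutive (@sigma G).
Implicit Types (h : G) (v a e : {set G}).

Lemma in_edge h h' : (h' \in edge h) = (h' == h) || (h' == sigma h).
Proof. by rewrite !inE. Qed.

Lemma edge_self h : h \in edge h.
Proof. by rewrite in_edge eqxx. Qed.

Lemma edge_sigma h : edge (sigma h) = edge h.
Proof. by rewrite /edge sigmaK setUC. Qed.

Lemma edge_mem h h' : h' \in edge h -> edge h' = edge h.
Proof. by rewrite in_edge => /orP[] /eqP-> //; rewrite edge_sigma. Qed.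

Lemma mem_edges h : edge h \in edges G.
Proof. exact: imset_f. Qed.

Lemma edges_mem a h : a \in edges G -> h \in a -> a = edge h.
Proof. by case/imsetP=> h' _ -> /edge_mem. Qed.

Lemma edges_ex a : a \in edges G -> exists h, a = edge h.
Proof. by case/imsetP=> h _ ->; exists h. Qed.

(** Vertices and signs of half-edges are inherited by a composition, while edges
   change, so steps are handled through the two half-edges at the common vertex. *)
Lemma edge_stepP e e' :
  reflect (exists v h h', [/\ v \in vert G, h \in v, h' \in v,
             sgn h & ~~ sgn h'] /\ e = edge h /\ e' = edge h')
          (edge_step e e').
Proof.
apply: (iffP and3P) => [[eE e'E /existsP[v]]|[v [h [h' [[vG hv h'v sh sh'] [-> ->]]]]]].
  case/andP=> /andP[vG /set0Pn[h hh]] /andP[_ /set0Pn[h' hh']]; move: hh hh'.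
  rewrite !inE => /andP[/andP[h'v sh'] h'e] /andP[/andP[hv sh] he].
  by exists v, h, h'; do !split=> //; apply: edges_mem.
split; rewrite ?mem_edges //; apply/existsP; exists v.
rewrite /is_target /is_source vG /=; apply/andP; split; apply/set0Pn.
  by exists h; rewrite !inE hv sh eqxx.
by exists h'; rewrite !inE h'v sh' eqxx.
Qed.

End Edges.

Section OneGraph.
Variable G : graph_data.
Hypothesis plG : planar G.
Implicit Types (h : G) (v a e : {set G}).

Lemma planar_sigmaK : involutive (@sigma G).
Proof. by case: plG => [[[]]]. Qed.
Hint Resolve planar_sigmaK : core.

Lemma vert_ex h : exists2 v, v \in vert G & h \in v.
Proof.
have [[[/and3P[/eqP cov _ _] _ _] _ _] _] := plG.
have : h \in cover (vert G) by rewrite cov inE.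
by case/bigcupP=> v vG hv; exists v.
Qed.

Lemma vert_eq v v' h :
  v \in vert G -> v' \in vert G -> h \in v -> h \in v' -> v = v'.
Proof.
have [[[/and3P[_ /trivIsetP tI _] _ _] _ _] _] := plG.
move=> vG v'G hv hv'; apply/eqP/idPn => neq.
by have /disjointFr := tI _ _ vG v'G neq => /(_ _ hv); rewrite hv'.
Qed.

Lemma vert_has_mem v : v \in vert G -> exists h, h \in v.
Proof.
have [[[/and3P[_ _ n0] _ _] _ _] _] := plG.
move=> vG; apply/set0Pn; apply: contraNneq n0 => <-; exact: vG.
Qed.

Lemma virtual_vert v h : v \in vert G -> h \in v -> in_virtual_edge h -> v = edge h.
Proof.
by move=> vG hv /andP[_ eG]; apply: (vert_eq vG eG hv); rewrite edge_self.
Qed.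

Lemma loop_virtual v h h' : v \in vert G -> h \in v -> h' \in v ->
  h' \in edge h -> h' != h -> v = edge h /\ in_virtual_edge h.
Proof.
have [[[_ _ gr] _ _] _] := plG.
move=> vG hv h'v; rewrite in_edge => /orP[/eqP->|/eqP e neq]; first by rewrite eqxx.
have sv : edge h \subset v.
  by apply/subsetP=> x; rewrite in_edge => /orP[] /eqP-> //; rewrite -e.
have ve : v = edge h by apply: gr => //; rewrite -e.
by split=> //; rewrite /in_virtual_edge -e neq -ve.
Qed.

Lemma virtual_mem h h' : h' \in edge h -> in_virtual_edge h' = in_virtual_edge h.
Proof.
move=> e; rewrite /in_virtual_edge (edge_mem _ e) //; congr (_ && _).
by move: e; rewrite in_edge => /orP[] /eqP-> //; rewrite planar_sigmaK eq_sym.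
Qed.

Lemma virtual_leg h : in_virtual_edge h -> leg h.
Proof. by rewrite /leg => ->; rewrite orbT. Qed.

Lemma edge_sgn_inj h h' : h' \in edge h -> sgn h' = sgn h -> h' = h.
Proof.
have [[_ ori _] _] := plG.
rewrite in_edge => /orP[] /eqP-> //; case: (sigma h =P h) => // /eqP /ori.
by move=> neq e; rewrite e eqxx in neq.
Qed.

Lemma out_leg_edge_inj o o' : o \in Out_G G -> o' \in Out_G G ->
  edge o = edge o' -> o = o'.
Proof.
rewrite !inE => /andP[_ so] /andP[_ so'] e; apply: edge_sgn_inj.
  by rewrite -e edge_self.
by rewrite (negbTE so) (negbTE so').
Qed.

Lemma prec_irr a : a \in edges G -> prec a a = false.
Proof. by have [_ [[irr _ _] _ _]] := plG => /irr/negbTE. Qed.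

Lemma prec_trans a b c : a \in edges G -> b \in edges G -> c \in edges G ->
  prec a b -> prec b c -> prec a c.
Proof. by have [_ [[_ tr _] _ _]] := plG => aE bE cE; apply: tr. Qed.

Lemma prec_asym a b : a \in edges G -> b \in edges G ->
  prec a b -> prec b a = false.
Proof.
move=> aE bE ab; apply/negP => ba.
by have := prec_trans aE bE aE ab ba; rewrite prec_irr.
Qed.

Lemma preceqN a b : a \in edges G -> b \in edges G ->
  ~~ preceq a b = prec b a.
Proof.
have [_ [[_ _ tot] _ _]] := plG => aE bE; rewrite /preceq negb_or.
case: eqVneq => [->|neq] /=; first by rewrite prec_irr.
have := tot a b aE bE; rewrite (negbTE neq) /=.
by case/orP=> [/[dup] ab ->|/[dup] ba ->]; rewrite prec_asym.
Qed.

Lemma preceqNgt a b : a \in edges G -> b \in edges G ->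
  preceq a b = ~~ prec b a.
Proof. by move=> aE bE; rewrite -preceqN // negbK. Qed.

Lemma preceq_trans a b c : a \in edges G -> b \in edges G -> c \in edges G ->
  preceq a b -> preceq b c -> preceq a c.
Proof.
move=> aE bE cE /predU1P[->//|ab] /predU1P[<-|bc]; rewrite /preceq ?ab ?orbT //.
by rewrite (prec_trans aE bE cE) ?orbT.
Qed.

Lemma prec_le_trans a b c : a \in edges G -> b \in edges G -> c \in edges G ->
  prec a b -> preceq b c -> prec a c.
Proof. by move=> aE bE cE ab /predU1P[<-//|]; apply: prec_trans. Qed.

Lemma le_prec_trans a b c : a \in edges G -> b \in edges G -> c \in edges G ->
  preceq a b -> prec b c -> prec a c.
Proof. by move=> aE bE cE /predU1P[->//|]; apply: prec_trans. Qed.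

Lemma preceq_tot a b : a \in edges G -> b \in edges G -> preceq a b || preceq b a.
Proof.
move=> aE bE; case: (boolP (preceq a b)) => //=.
by rewrite preceqN // /preceq => ->; rewrite orbT.
Qed.

Lemma reach_prec a b : a \in edges G -> b \in edges G -> reach a b -> preceq a b.
Proof.
have [_ [_ p1 _]] := plG => aE bE ab; rewrite /preceq.
by case: eqVneq => //= neq; apply: p1.
Qed.

(** An outgoing real leg has no target, and the target of a virtual edge is
   the virtual vertex, which is the source of this edge only. *)
Lemma out_leg_reach o e : o \in Out_G G -> reach (edge o) e -> e = edge o.
Proof.
rewrite inE => /andP[lo so] /connectP[p].
elim: p => [_ -> //|e' p IHp] /= /andP[st pth] lst.
suff e'o : e' = edge o by rewrite e'o in pth lst; apply: IHp.
case/(edge_stepP planar_sigmaK): st => v [h [h' [[vG hv h'v sh sh'] [oh ->]]]].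
have ho : h \in edge o by rewrite oh edge_self.
have : h == sigma o.
  by move: ho; rewrite in_edge => /orP[/eqP hh|//]; rewrite hh (negbTE so) in sh.
move/eqP=> hs; have vo : in_virtual_edge o.
  by case/orP: lo => [/eqP so'|//]; rewrite hs so' (negbTE so) in sh.
have ve : v = edge h by apply: virtual_vert; rewrite // (virtual_mem ho).
by rewrite oh; apply: edge_mem; rewrite // -ve.
Qed.

(** Every vertex has an outgoing half-edge, so a path of edges can be prolonged
   until it meets a leg; by acyclicity this happens after finitely many steps. *)
Lemma reach_out_leg e : e \in edges G -> exists2 o, o \in Out_G G & reach e (edge o).
Proof.
have [[_ ori dir] [_ p1 _]] := plG.
have [n] := ubnP #|[set e' in edges G | prec e e']|.
elim: n => // n IHn in e *; rewrite ltnS => le_n eE.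
have [h eh] := edges_ex eE.
have [/existsP[k /andP[ke sk]] | /existsPn noplus] :=
    boolP [exists k, (k \in e) && sgn k]; last first.
  exists h; last by rewrite eh; apply: connect0.
  have minus k : k \in edge h -> ~~ sgn k.
    by move=> ke; have := noplus k; rewrite eh ke.
  rewrite inE minus ?edge_self // andbT /leg; case: eqVneq => //= neq.
  have := ori h neq; rewrite (negbTE (minus h _)) ?edge_self //.
  by rewrite (negbTE (minus (sigma h) _)) // in_edge eqxx orbT.
have {eh}ek : e = edge k by apply: edges_mem.
have [v vG kv] := vert_ex k.
have [_ /set0Pn[k']] := dir v vG; rewrite inE => /andP[k'v sk'].
have st : edge_step e (edge k') by apply/(edge_stepP planar_sigmaK); exists v, k, k'.
have [ee'|neq] := eqVneq (edge k') e.
  exists k'; last by rewrite ee'; apply: connect0.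
  rewrite inE sk' andbT virtual_leg //.
  have k'e : k' \in edge k by rewrite -ek -ee' edge_self.
  rewrite (virtual_mem k'e); case: (loop_virtual vG kv k'v) => //.
  by apply: contraNneq sk' => ->.
have pr : prec e (edge k').
  by apply: p1; rewrite ?mem_edges // 1?eq_sym //; apply: connect1.
have [||o oG ro] := IHn (edge k'); rewrite ?mem_edges //; last first.
  by exists o => //; apply: connect_trans ro; apply: connect1.
apply: leq_trans le_n; apply: proper_card; apply/properP; split.
  apply/subsetP=> x; rewrite !inE => /andP[xE px]; rewrite xE /=.
  by apply: prec_trans pr px; rewrite ?mem_edges.
by exists (edge k'); rewrite !inE ?mem_edges //= prec_irr ?mem_edges.
Qed.

(** Irreflexivity of the order gives the distinctness that (P2) asks for. *)
Lemma planar_P2 a b c : a \in edges G -> b \in edges G -> c \in edges G ->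
  reach a b -> prec a c -> prec c b -> reach a c \/ reach c b.
Proof.
have [_ [_ _ p2]] := plG => aE bE cE ab ac cb; apply: p2 => //.
have ab' : prec a b by apply: prec_trans ac cb.
rewrite /= !inE negb_or; apply/and3P; split=> //; [apply/andP; split|];
by apply/eqP=> e; move: ac cb ab'; rewrite e prec_irr.
Qed.

(** Axiom (P2) offers a path from [a] to [o] or one from [o] to [b]; the second
   is impossible, as nothing leaves an outgoing leg. *)
Lemma reach_between_out_leg a b o : a \in edges G -> b \in edges G ->
  o \in Out_G G -> reach a b -> preceq a (edge o) -> prec (edge o) b ->
  reach a (edge o).
Proof.
move=> aE bE oG ab /predU1P[->|ao] ob; first exact: connect0.
have [//|/(out_leg_reach oG) e] := planar_P2 aE bE (mem_edges o) ab ao ob.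
by rewrite e prec_irr ?mem_edges in ob.
Qed.

(** If the outgoing leg that [a] is known to reach comes after [o], then [o] lies
   between, and [a] reaches [o] itself. *)
Lemma reach_out_leg_before a o : a \in edges G -> o \in Out_G G ->
  preceq a (edge o) ->
  exists o', [/\ o' \in Out_G G, reach a (edge o') & preceq (edge o') (edge o)].
Proof.
move=> aE oG ao; have [o' o'G ro'] := reach_out_leg aE.
case: (boolP (preceq (edge o') (edge o))) => [le|]; first by exists o'.
rewrite preceqN ?mem_edges // => oo'.
exists o; split=> //; last by rewrite /preceq eqxx.
by apply: reach_between_out_leg ro' ao oo'; rewrite ?mem_edges.
Qed.

Lemma edge_seqP (a : {set G}) : (a \in edge_seq G) = (a \in edges G).
Proof. by rewrite mem_sort mem_enum. Qed.

Lemma pairwise_edge_seq : pairwise (@preceq G) (edge_seq G).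
Proof.
have aE : all [in edges G] (edge_seq G).
  by apply/allP=> a; rewrite edge_seqP.
rewrite -(sorted_pairwise_in (P := [in edges G])) //.
  apply: (sort_sorted_in (P := [in edges G])); first exact: preceq_tot.
  by apply/allP=> a; rewrite mem_enum.
by move=> b a c bE aE' cE; apply: preceq_trans.
Qed.

Lemma mem_sort_legs (A : {set G}) h : (h \in sort_legs A) = (h \in A).
Proof. by rewrite mem_sort mem_enum. Qed.

Lemma size_sort_legs (A : {set G}) : size (sort_legs A) = #|A|.
Proof. by rewrite size_sort cardE. Qed.

Lemma sort_legs_prec (A : {set G}) h0 i j : {in A &, injective (@edge G)} ->
  i < j -> j < size (sort_legs A) ->
  prec (edge (nth h0 (sort_legs A) i)) (edge (nth h0 (sort_legs A) j)).
Proof.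
move=> injA ij js.
set r := fun h h' : G => preceq (edge h) (edge h').
have srt : sorted r (sort_legs A).
  by apply: sort_sorted => h h'; apply: preceq_tot; rewrite ?mem_edges.
have tr : transitive r.
  by move=> h' h h''; apply: preceq_trans; rewrite ?mem_edges.
have := sorted_ltn_nth tr h0 srt; move/(_ i j).
rewrite !inE js (ltn_trans ij js) => /(_ isT isT ij) /predU1P[|//].
move/injA; rewrite -!mem_sort_legs !mem_nth ?(ltn_trans ij js) //.
move=> /(_ isT isT)/eqP.
by rewrite nth_uniq ?(ltn_trans ij js) ?sort_uniq ?enum_uniq // (ltn_eqF ij).
Qed.

End OneGraph.

(** * The opposite graph *)

(** The opposite graph exchanges incoming and outgoing legs.  Composition glues
   outgoing legs of [G1] to outgoing legs of [op G2], which makes the roles of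
   the two graphs symmetric. *)
Definition op (G : graph_data) : graph_data :=
  @GraphData G (vert G) (@sigma G) (fun h => ~~ sgn h) (fun e e' => prec e' e).

Lemma edge_step_op (G : graph_data) e e' : @edge_step (op G) e e' = @edge_step G e' e.
Proof.
have swap v : @is_target (op G) v e = @is_source G v e by [].
have swap' v : @is_source (op G) v e' = @is_target G v e'.
  rewrite /is_source /is_target; congr (_ && (_ :&: _ != _)).
  by apply/setP=> h; rewrite !inE negbK.
rewrite /edge_step [RHS]andbCA; congr [&& _, _ & _].
by apply: eq_existsb => v; rewrite swap swap' andbC.
Qed.

Lemma reach_op (G : graph_data) e e' : @reach (op G) e e' = @reach G e' e.
Proof.
rewrite /reach -[RHS](connect_rev (@edge_step G) e e').
by apply: eq_connect => x y; rewrite edge_step_op.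
Qed.

Lemma planar_op (G : graph_data) : planar G -> planar (op G).
Proof.
case=> [[gr ori dir] [[irr tr tot] p1 p2]]; split; split=> //.
- by move=> h /ori; apply: contraNneq => /negb_inj ->.
- move=> v /dir[i o]; split=> //; apply: contraNneq i => e.
  rewrite -[X in _ == X]e; apply/eqP/setP=> h; by rewrite !inE negbK.
- split=> //.
  + by move=> b a c bE aE cE ba cb; apply: (tr b).
  + by move=> a b aE bE; rewrite [X in _ || X]orbC; apply: tot.
- move=> a b aE bE neq; rewrite reach_op; apply: p1 => //; by rewrite eq_sym.
- move=> a b c aE bE cE u; rewrite !reach_op => ba ca bc.
  have u' : uniq [:: b; a; c].
    by move: u; rewrite /= !inE !negb_or (eq_sym b a) => /and3P[/andP[-> ->] -> _].
  by have := p2 _ _ _ bE aE cE u' ba bc ca => -[]; [right|left].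
Qed.

Lemma preceq_op (K : graph_data) (e e' : {set K}) : @preceq (op K) e e' = @preceq K e'
  e.
Proof. by rewrite /preceq eq_sym. Qed.

Lemma Out_op (G : graph_data) : Out_G (op G) = In_G G.
Proof. by apply/setP=> h; rewrite !inE negbK. Qed.

(** * Grafted legs *)

Section Composition.
Variables G1 G2 : graph_data.
Hypotheses (pl1 : planar G1) (pl2 : planar G2).
Hypothesis cardOI : #|Out_G G1| = #|In_G G2|.

Notation grafts := (grafts G1 G2).
Notation deleted := (deleted G1 G2).
Notation comp_half := (comp_half G1 G2).

(** The side [true] is the first graph, the side [false] the opposite of the
   second.  Statements for an arbitrary side [b], the other one being [~~ b],
   cover each argument and its dual. *)
Definition side (b : bool) : graph_data := if b then G1 else op G2.

Definition inj (b : bool) : side b -> (G1 + G2)%type :=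
  if b return side b -> (G1 + G2)%type then inl else inr.

Definition leg_of (b : bool) (p : G1 * G2) : side b :=
  if b return side b then p.1 else p.2.

Definition virt (b : bool) (p : G1 * G2) : bool :=
  if b then in_virtual_edge p.1 else in_virtual_edge p.2.

Lemma planar_side b : planar (side b).
Proof. by case: b => //; apply: planar_op. Qed.
Hint Resolve planar_side : core.

Lemma sigma_side b : involutive (@sigma (side b)).
Proof. exact: planar_sigmaK. Qed.
Hint Resolve sigma_side : core.

Lemma virtE b p : in_virtual_edge (leg_of b p) = virt b p.
Proof. by case: b. Qed.

Lemma inj_inj b : injective (@inj b).
Proof. by case: b => x y []. Qed.

Lemma eq_injE b (h h' : side b) : (inj h == inj h') = (h == h').
Proof. exact: inj_eq (@inj_inj b) _ _. Qed.

Lemma inj_neq b (h : side b) (h' : side (~~ b)) : (inj h' == inj h) = false.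
Proof. by case: b h h'. Qed.

Lemma inj_ex (u : G1 + G2) : exists b (h : side b), u = inj h.
Proof. by case: u => h; [exists true, h | exists false, h]. Qed.

Let n := size grafts.

Lemma size_outs : size (outs G1) = n.
Proof. by rewrite /n size1_zip !size_sort_legs ?cardOI. Qed.

Lemma size_ins : size (ins G2) = n.
Proof. by rewrite /n size2_zip !size_sort_legs ?cardOI. Qed.

Lemma grafts_nth p k : k < n ->
  nth p grafts k = (nth p.1 (outs G1) k, nth p.2 (ins G2) k).
Proof. by case: p => o i kn; rewrite nth_zip // size_outs size_ins. Qed.

Lemma graft_ex p : p \in grafts -> exists2 k, k < n & p = nth p grafts k.
Proof.
by move=> pg; exists (index p grafts); rewrite ?index_mem ?nth_index.
Qed.

Lemma leg_of_out b p : p \in grafts -> leg_of b p \in Out_G (side b).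
Proof.
move=> /graft_ex[k kn]; rewrite grafts_nth // => ->.
case: b => /=; last rewrite Out_op; rewrite -mem_sort_legs mem_nth //.
  by rewrite size_outs.
by rewrite size_ins.
Qed.

Lemma out_leg_of b (h : side b) : h \in Out_G (side b) ->
  exists2 p, p \in grafts & leg_of b p = h.
Proof.
case: b h => /= h; last rewrite Out_op; rewrite -mem_sort_legs => hl.
  have kn : index h (outs G1) < n by rewrite -size_outs index_mem.
  have : 0 < size (ins G2) by rewrite size_ins; case: n kn.
  case: (ins G2) (erefl (ins G2)) => // i0 s _ _.
  pose p := nth (h, i0) grafts (index h (outs G1)).
  exists p; first exact: mem_nth.
  by rewrite /p grafts_nth //= nth_index.
have kn : index h (ins G2) < n by rewrite -size_ins index_mem.
have : 0 < size (outs G1) by rewrite size_outs; case: n kn.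
case: (outs G1) (erefl (outs G1)) => // o0 s _ _.
pose p := nth (o0, h) grafts (index h (ins G2)).
exists p; first exact: mem_nth.
by rewrite /p grafts_nth //= nth_index.
Qed.

Lemma graft_nth_prec b p i j : i < j -> j < n ->
  let e k := edge (leg_of b (nth p grafts k)) in
  if b then @prec (side b) (e i) (e j) else @prec (side b) (e j) (e i).
Proof.
move=> ij jn /=; have i_n := ltn_trans ij jn.
case: b; rewrite /= !grafts_nth //=.
  apply: sort_legs_prec; rewrite // -/(outs G1) ?size_outs //.
  by move=> o o'; apply: out_leg_edge_inj.
apply: (@sort_legs_prec G2); rewrite // -/(ins G2) ?size_ins //.
by rewrite -Out_op => o o'; apply: (@out_leg_edge_inj (op G2)); apply: planar_op.
Qed.

Lemma leg_of_inj b p q : p \in grafts -> q \in grafts ->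
  edge (leg_of b p) = edge (leg_of b q) -> p = q.
Proof.
move=> /graft_ex[k kn pk] /graft_ex[l ln ql].
rewrite pk ql (set_nth_default p q) // => e.
have irr x : x \in edges (side b) -> prec x x = false by apply: prec_irr.
case: (ltngtP k l) => [kl|lk|-> //].
  have := @graft_nth_prec b p _ _ kl ln; rewrite /= e.
  by case: (b) irr => irr; rewrite irr ?mem_edges.
have := @graft_nth_prec b p _ _ lk kn; rewrite /= e.
by case: (b) irr => irr; rewrite irr ?mem_edges.
Qed.

(** The k-th outgoing leg meets the k-th incoming leg; as the second graph is
   seen through its opposite, this correspondence is decreasing. *)
Lemma leg_of_prec b p q : p \in grafts -> q \in grafts ->
  prec (edge (leg_of b p)) (edge (leg_of b q)) ->
  prec (edge (leg_of (~~ b) q)) (edge (leg_of (~~ b) p)).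
Proof.
move=> /graft_ex[k kn pk] /graft_ex[l ln ql].
rewrite pk ql (set_nth_default p q) // => pr.
have asym x y : x \in edges (side b) -> y \in edges (side b) ->
  prec x y -> prec y x = false by apply: prec_asym.
case: (ltngtP k l) => [kl|lk|e].
- have := @graft_nth_prec b p _ _ kl ln; have := @graft_nth_prec (~~ b) p _ _ kl ln.
  case: (b) asym pr => asym pr; first by move=> + _.
  by move=> _ /= rp; have /= := asym _ _ (mem_edges _) (mem_edges _) pr; rewrite rp.
- have := @graft_nth_prec b p _ _ lk kn; have := @graft_nth_prec (~~ b) p _ _ lk kn.
  case: (b) asym pr => asym pr; last by move=> + _.
  by move=> _ /= rp; have /= := asym _ _ (mem_edges _) (mem_edges _) pr; rewrite rp.
by move: pr; rewrite e prec_irr ?mem_edges.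
Qed.

Lemma leg_of_preceq b p q : p \in grafts -> q \in grafts ->
  preceq (edge (leg_of b p)) (edge (leg_of b q)) ->
  preceq (edge (leg_of (~~ b) q)) (edge (leg_of (~~ b) p)).
Proof.
move=> pg qg /predU1P[/leg_of_inj-> //|/leg_of_prec pr].
  by rewrite /preceq eqxx.
by rewrite /preceq pr ?orbT.
Qed.

Lemma mem_inl_set (A : {set G1}) b (h : side b) : (inj h \in inl_set G2 A) =
  (if b return side b -> bool then fun h => h \in A else fun=> false) h.
Proof.
by case: b h => /= h; [apply: mem_imset; apply: inl_inj | apply/imsetP => -[]].
Qed.

Lemma mem_inr_set (A : {set G2}) b (h : side b) : (inj h \in inr_set G1 A) =
  (if b return side b -> bool then fun=> false else fun h => h \in A) h.
Proof.
by case: b h => /= h; [apply/imsetP => -[] | apply: mem_imset; apply: inr_inj].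
Qed.

Lemma mem_pair o i b (h : side b) :
  (inj h \in [set inl o; inr i]) = (h == leg_of b (o, i)).
Proof. by case: b h => /= h; rewrite !inE ?orbF. Qed.

Lemma mem_graft_del b (h : side b) p : (inj h \in graft_del p) =
  [&& h \in edge (leg_of b p), virt b p & (h == leg_of b p) || ~~ virt (~~ b) p].
Proof.
case: p => o i; rewrite /graft_del.
have self : h == leg_of b (o, i) -> h \in edge (leg_of b (o, i)).
  by move=> /eqP->; rewrite edge_self.
case: (boolP (in_virtual_edge o)) => vo; case: (boolP (in_virtual_edge i)) => vi;
  rewrite ?mem_pair ?mem_inl_set ?mem_inr_set ?in_set0;
  case: b h self => h /= self; rewrite /virt /= ?vo ?vi ?(negbTE vo) ?(negbTE vi);
  rewrite ?orbT ?orbF ?andbF ?andbT //.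
all: by case: (eqVneq h _) self => [_ -> | _ _]; rewrite ?andbF.
Qed.

Lemma leg_sigma b p : p \in grafts -> (sigma (leg_of b p) == leg_of b p) = ~~ virt b p.
Proof.
move=> /(leg_of_out b); rewrite inE /leg -virtE => /andP[+ _].
by case: (boolP (in_virtual_edge _)) => [/andP[/negbTE-> _] _|_]; rewrite ?orbF.
Qed.

Lemma mem_graft_edge b (h : side b) p : p \in grafts ->
  (inj h \in graft_edge p) =
  (h \in edge (leg_of b p)) && (virt b p ==> virt (~~ b) p && (h != leg_of b p)).
Proof.
move=> pg; have := leg_sigma b pg.
case: p pg => o i pg; rewrite /graft_edge.
case: (boolP (in_virtual_edge o)) => vo; case: (boolP (in_virtual_edge i)) => vi;
  rewrite ?mem_inl_set ?mem_inr_set ?mem_pair;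
  case: b h => h; rewrite /virt /= ?vo ?vi ?(negbTE vo) ?(negbTE vi) /= => so;
  rewrite ?andbF ?andbT // in_edge.
- by case: (h =P sigma o) => [->|]; rewrite ?orbT ?orbF ?so ?andbN.
- by case: (h =P sigma i) => [->|]; rewrite ?orbT ?orbF ?so ?andbN.
- by rewrite (eqP so) orbb.
- by rewrite (eqP so) orbb.
Qed.

Lemma mem_deleted b (h : side b) : (inj h \in deleted) =
  [exists p in grafts, [&& h \in edge (leg_of b p), virt b p &
                           (h == leg_of b p) || ~~ virt (~~ b) p]].
Proof.
apply/bigcupP/exists_inP => -[p pg]; first by rewrite mem_graft_del; exists p.
by rewrite -mem_graft_del; exists p.
Qed.

(** * Edges of the composition *)

(** The image in the composition of an edge of one side.  Where the edge is not
   grafted it is kept; where it is, the surviving half-edges of its partner on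
   the other side are added. *)
Definition glued (b : bool) (a : {set side b}) : {set comp_half} :=
  [set x | [exists h in a, inj h == val x] ||
    [exists p in grafts, (edge (leg_of b p) == a) &&
       [exists h in edge (leg_of (~~ b) p), inj h == val x]]].

Lemma val_ex (x : comp_half) : exists b (h : side b), val x = inj h.
Proof. exact: inj_ex. Qed.

Lemma mem_inj_exists b (a : {set side b}) (h : side b) (x : comp_half) :
  val x = inj h -> [exists h' in a, inj h' == val x] = (h \in a).
Proof.
move=> ->; apply/exists_inP/idP => [[h' ha /eqP/inj_inj <-] //|ha].
by exists h.
Qed.

Lemma in_glued b (a : {set side b}) (h : side b) (x : comp_half) :
  val x = inj h -> a \in edges (side b) -> (x \in glued a) = (h \in a).
Proof.
move=> xh aE; rewrite inE (mem_inj_exists _ xh); case: (h \in a) => //=.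
apply/exists_inP => -[p _ /andP[_ /exists_inP[h' _]]].
by rewrite xh inj_neq.
Qed.

Lemma in_glued_other b (a : {set side b}) (h : side (~~ b)) (x : comp_half) :
  val x = inj h -> (x \in glued a) =
  [exists p in grafts, (edge (leg_of b p) == a) && (h \in edge (leg_of (~~ b) p))].
Proof.
move=> xh; rewrite inE; have -> /= : [exists h' in a, inj h' == val x] = false.
  by apply/exists_inP => -[h' _]; rewrite xh eq_sym inj_neq.
apply: eq_existsb => p; congr (_ && (_ && _)).
exact: mem_inj_exists.
Qed.

Lemma in_glued_otherN b (a : {set side (~~ b)}) (h : side b) (x : comp_half) :
  val x = inj h -> (x \in glued a) =
  [exists p in grafts, (edge (leg_of (~~ b) p) == a) && (h \in edge (leg_of b p))].
Proof.
by case: b a h => a h; [apply: (@in_glued_other false) | apply: (@in_glued_other true)].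
Qed.

Lemma mem_glued_graft c (h : side c) b p (x : comp_half) :
  val x = inj h -> p \in grafts ->
  (x \in glued (edge (leg_of b p))) = (h \in edge (leg_of c p)).
Proof.
move=> xh pg; case: (eqVneq c b) => [e|neq].
  by case: _ / e; rewrite (in_glued xh) ?mem_edges.
have {neq} e : c = ~~ b by case: b c {h xh} neq => -[].
move: h xh; rewrite e => h xh; rewrite (in_glued_other _ xh).
apply/exists_inP/idP => [[q qg /andP[/eqP/leg_of_inj->//]]|ho].
by exists p; rewrite ?eqxx.
Qed.

Lemma glued_graft b c p : p \in grafts ->
  glued (edge (leg_of b p)) = glued (edge (leg_of c p)).
Proof.
move=> pg; apply/setP=> x; have [d [h xh]] := val_ex x.
by rewrite !(mem_glued_graft _ xh).
Qed.

Lemma mem_edge_leg b (h : side b) p q : p \in grafts -> q \in grafts ->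
  h \in edge (leg_of b p) -> h \in edge (leg_of b q) -> p = q.
Proof.
move=> pg qg hp hq; apply: (@leg_of_inj b) => //.
by rewrite -(edge_mem _ hp) // -(edge_mem _ hq).
Qed.

(** Whatever the kinds of the two legs, the new edge is what survives of the
   two grafted edges.  This makes the four cases of grafting uniform. *)
Lemma mem_graft_edge_kept c (h : side c) p : p \in grafts ->
  (inj h \in graft_edge p) = (h \in edge (leg_of c p)) && (inj h \notin deleted).
Proof.
move=> pg; rewrite mem_graft_edge //.
case: (boolP (h \in edge (leg_of c p))) => //= hp.
rewrite mem_deleted; apply/idP/exists_inPn => [keep q qg|/(_ p pg)].
  apply/negP => /and3P[hq]; rewrite -(mem_edge_leg pg qg hp hq) => vp.
  by move: keep; rewrite vp /= => /andP[-> /negbTE->].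
rewrite hp /=; case: virt => //=; rewrite negb_or negbK => /andP[-> ->] //.
Qed.

Lemma restr_graft_edge b p : p \in grafts ->
  restr (graft_edge p) = glued (edge (leg_of b p)).
Proof.
move=> pg; apply/setP=> x; have [c [h xh]] := val_ex x.
rewrite inE xh mem_graft_edge_kept // (mem_glued_graft _ xh) // -xh (valP x).
by rewrite andbT.
Qed.

Definition inj_set b (A : {set side b}) : {set (G1 + G2)%type} := [set inj h | h in A].

Lemma mem_inj_set b (A : {set side b}) h : (inj h \in inj_set A) = (h \in A).
Proof. by apply: mem_imset; apply: inj_inj. Qed.

Lemma mem_inj_setN b (A : {set side b}) (h : side (~~ b)) : (inj h \in inj_set A) =
  false.
Proof. by apply/imsetP => -[h' _ /eqP]; rewrite inj_neq. Qed.

Lemma graft_edge_pair (p : G1 * G2) : exists u v, graft_edge p = [set u; v].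
Proof.
case: p => o i; rewrite /graft_edge /edge /inl_set /inr_set.
have pairE (T T' : finType) (f : T -> T') u v :
    [set f x | x in [set u; v]] = [set f u; f v].
  by rewrite imsetU1 imset_set1.
case: ifP => _; case: ifP => _; rewrite ?pairE; first last.
- by exists (inl o), (inr i).
- by exists (inl o), (inl (sigma o)).
- by exists (inr i), (inr (sigma i)).
by exists (inl (sigma o)), (inr (sigma i)).
Qed.

Notation cedge := (@edge (graph_comp G2 G1)).

Lemma in_cedge (x y : comp_half) : sum_sigma (val x) \notin deleted ->
  (y \in cedge x) = (val y \in [set val x; sum_sigma (val x)]).
Proof.
move=> nd; rewrite !inE -(inj_eq val_inj y) -(inj_eq val_inj y) /=.
by rewrite /comp_sigma insubdK.
Qed.

(** The partner of [x] is found either inside the new edge that contains [x] or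
   by the old involution; [glued] describes both cases at once. *)
Lemma cedge_glued b (h : side b) (x : comp_half) : val x = inj h ->
  cedge x = glued (edge h).
Proof.
move=> xh; have ndx := valP x.
have [/exists_inP[p pg xp]|nox] := boolP [exists p in grafts, val x \in graft_edge p].
  have hp : h \in edge (leg_of b p) by move: xp;
    rewrite xh mem_graft_edge_kept // => /andP[].
  rewrite (edge_mem _ hp) // -restr_graft_edge //.
  have sE : [set val x; sum_sigma (val x)] = graft_edge p.
    rewrite /sum_sigma; case: pickP => [q /andP[qg xq]|/(_ p)]; last by rewrite pg xp.
    have -> : q = p.
      apply: (@mem_edge_leg _ h) => //.
      by move: xq; rewrite xh mem_graft_edge_kept // => /andP[].
    by have [u [v e]] := graft_edge_pair p; rewrite e pair_other // -e.
  apply/setP=> y; rewrite in_cedge ?sE ?inE //.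
  have : sum_sigma (val x) \in graft_edge p by rewrite -sE !inE eqxx orbT.
  have [c [k ->]] := inj_ex (sum_sigma (val x)).
  by rewrite mem_graft_edge_kept // => /andP[].
have nogr p : p \in grafts -> h \notin edge (leg_of b p).
  move=> pg; apply: contra nox => hp; apply/exists_inP; exists p => //.
  by rewrite xh mem_graft_edge_kept // hp -xh.
have sE : sum_sigma (val x) = inj (sigma h).
  rewrite /sum_sigma; case: pickP => [p /andP[pg xp]|_].
    by case/exists_inP: nox; exists p.
  by rewrite xh; case: (b) (h).
have nds : sum_sigma (val x) \notin deleted.
  rewrite sE mem_deleted; apply/exists_inPn => p /nogr; apply: contra.
  by move=> /and3P[/(edge_mem (@sigma_side b))]; rewrite edge_sigma // => <-;
    rewrite edge_self.
apply/setP=> y; rewrite in_cedge // sE xh; have [c [k yk]] := val_ex y.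
case: (eqVneq c b) => [e|neq].
  case: _ / e in h xh ndx nox nogr sE nds *.
  by rewrite (in_glued yk) ?mem_edges // yk !inE !eq_injE.
have {neq} e : c = ~~ b by case: b c {h xh ndx nox nogr sE nds k yk} neq => -[].
move: k yk; rewrite e => k yk; rewrite (in_glued_other _ yk) yk !inE !inj_neq.
apply/esym/exists_inP => -[p /nogr hp /andP[/eqP e' _]].
by rewrite e' edge_self in hp.
Qed.

Lemma glued_cedge b (a : {set side b}) (x : comp_half) : a \in edges (side b) ->
  x \in glued a -> glued a = cedge x.
Proof.
move=> aE; have [c [k xk]] := val_ex x.
case: (eqVneq c b) => [e|neq].
  case: _ / e in a aE *; rewrite (in_glued xk) // => ka.
  by rewrite (cedge_glued xk) (edges_mem _ aE ka).
have {neq} e : c = ~~ b by case: b c {a aE k xk} neq => -[].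
move: k xk; rewrite e => k xk; rewrite (in_glued_other _ xk).
move=> /exists_inP[p pg /andP[/eqP<- kp]].
by rewrite (cedge_glued xk) (edge_mem _ kp) // (glued_graft b (~~ b)).
Qed.

(** No edge disappears: if a half-edge of [a] is deleted, then [a] is grafted
   and the new edge, which is not empty, is its image. *)
Lemma glued_ex b (a : {set side b}) : a \in edges (side b) -> exists x, x \in glued a.
Proof.
move=> aE; have [h ah] := edges_ex aE.
have [hd|hd] := boolP (inj h \in deleted); last first.
  by exists (Sub (inj h) hd); rewrite (in_glued (SubK _ _)) // ah edge_self.
move: hd; rewrite mem_deleted => /exists_inP[p pg /and3P[hp _ _]].
have [u [v e]] := graft_edge_pair p.
have up : u \in graft_edge p by rewrite e !inE eqxx.
have [c [k uk]] := inj_ex u.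
move: (up); rewrite uk mem_graft_edge_kept // => /andP[kp kd].
exists (Sub (inj k) kd); rewrite ah (edge_mem _ hp) // (glued_graft b c) //.
by rewrite (in_glued (SubK _ _)) ?mem_edges.
Qed.

Lemma cedges_glued e : e \in edges (graph_comp G2 G1) ->
  exists b (a : {set side b}), a \in edges (side b) /\ e = glued a.
Proof.
case/imsetP=> x _ ->; have [b [h xh]] := val_ex x.
by exists b, (edge h); rewrite mem_edges (cedge_glued xh).
Qed.

(** With [glued_inj], this says that the edges of the composition are the edges of
   the two graphs with grafted pairs identified; in particular a path of the
   composition can change graphs only at a grafted edge. *)
Lemma glued_eq_other b (a : {set side b}) (a' : {set side (~~ b)}) :
  a \in edges (side b) -> a' \in edges (side (~~ b)) -> glued a = glued a' ->
  exists2 p, p \in grafts & a = edge (leg_of b p) /\ a' = edge (leg_of (~~ b) p).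
Proof.
move=> aE a'E e; have [x] := glued_ex aE; have [c [k xk]] := val_ex x.
move=> /[dup] xa; rewrite e => xa'.
case: (eqVneq c b) => [ecb|neq].
  subst c.
  move: xa; rewrite (in_glued xk) // => ka; rewrite (edges_mem _ aE ka) //.
  move: xa'; rewrite (in_glued_otherN _ xk) => /exists_inP[p pg /andP[/eqP<- kp]].
  by exists p => //; rewrite (edge_mem _ kp).
have {neq} ecb : c = ~~ b by case: b c {a a' aE a'E e xa xa' k xk} neq => -[].
move: k xk; rewrite ecb => k xk.
move: xa; rewrite (in_glued_other _ xk) => /exists_inP[p pg /andP[/eqP<- kp]].
exists p => //; split=> //.
move: xa'; rewrite (in_glued xk) // => /(edges_mem _ a'E) -> //.
by rewrite (edge_mem _ kp).
Qed.

Lemma glued_inj b (a a' : {set side b}) :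
  a \in edges (side b) -> a' \in edges (side b) -> glued a = glued a' -> a = a'.
Proof.
move=> aE a'E e; have [x xa] := glued_ex aE; have [c [k xk]] := val_ex x.
move: (xa); rewrite e => xa'.
case: (eqVneq c b) => [ecb|neq].
  subst c.
  move: xa xa'; rewrite !(in_glued xk) // => /(edges_mem _ aE) -> //.
  by move/(edges_mem _ a'E) -> .
have {neq} ecb : c = ~~ b by case: b c {a a' aE a'E e xa xa' k xk} neq => -[].
move: k xk; rewrite ecb => k xk; move: xa xa'; rewrite !(in_glued_other _ xk).
move=> /exists_inP[p pg /andP[/eqP<- kp]] /exists_inP[q qg /andP[/eqP<- kq]].
by rewrite (mem_edge_leg pg qg kp kq).
Qed.

(** * Vertices of the composition *)

Notation G := (graph_comp G2 G1).

Lemma virtual_graft b (h : side b) : in_virtual_edge h ->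
  exists2 p, p \in grafts & h \in edge (leg_of b p).
Proof.
move=> vh; have [[_ ori _] _] := planar_side b.
have [sh|sh] := boolP (sgn h); last first.
  have [|p pg e] := @out_leg_of b h; first by rewrite inE virtual_leg.
  by exists p; rewrite // e edge_self.
have [|p pg e] := @out_leg_of b (sigma h).
  rewrite inE virtual_leg ?(virtual_mem _ (h := h)) //;
    last by rewrite in_edge eqxx orbT.
  by have /andP[/ori] := vh; rewrite sh; case: sgn.
by exists p; rewrite // e edge_sigma // edge_self.
Qed.

(** Deleted half-edges lie in virtual edges, and each virtual edge, having an
   outgoing leg, meets the deleted part. *)
Lemma vert_undeleted b (v : {set side b}) (h : side b) :
  v \in vert (side b) -> h \in v ->
  [disjoint inj_set v & deleted] = ~~ in_virtual_edge h.
Proof.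
move=> vG hv; apply/idP/idP => [dis|nv].
  apply/negP => vh; have [p pg hp] := virtual_graft vh.
  have pv : leg_of b p \in v.
    by rewrite (virtual_vert _ vG hv) // (edge_mem _ hp) // edge_self.
  have /(disjointFr dis) : inj (leg_of b p) \in inj_set v by rewrite mem_inj_set.
  move/negbT; rewrite mem_deleted => /exists_inPn/(_ p pg).
  by rewrite edge_self eqxx -virtE -(virtual_mem _ hp) ?vh.
rewrite disjoint_subset; apply/subsetP => _ /imsetP[h' h'v ->].
rewrite inE mem_deleted; apply/exists_inPn => p pg; apply: contra nv.
case/and3P=> h'p vp _; rewrite -virtE -(virtual_mem _ h'p) // in vp.
rewrite (virtual_mem _ (h := h')) // -(virtual_vert _ vG h'v) //.
Qed.

Lemma comp_vertP (V : {set comp_half}) : reflect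
  ((exists b (v : {set side b}), [/\ v \in vert (side b),
      [disjoint inj_set v & deleted] & V = restr (inj_set v)]) \/
   (exists p, [/\ p \in grafts, virt true p && virt false p &
     V = restr (graft_edge p)]))
  (V \in comp_vert G1 G2).
Proof.
rewrite /comp_vert inE in_setU; apply: (iffP idP).
  case/orP=> [/orP[]|] /imsetP[v]; rewrite inE => /andP[vG dis] ->.
  - by left; exists true, v.
  - by left; exists false, v.
  - by right; exists v.
case=> [[b [v [vG dis ->]]]|[p [pg vp ->]]].
  case: b v vG dis => v vG dis; apply/orP; left; apply/orP; [left|right];
  apply/imsetP; exists v => //; rewrite inE; by apply/andP.
by apply/orP; right; apply/imsetP; exists p; rewrite // inE pg.
Qed.

(** The vertex of [x] is determined by [x], whence the vertices of the composition
   are disjoint: a virtual half-edge survives only in a virtual new edge. *)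
Lemma comp_vert_of b (h : side b) (x : comp_half) V : val x = inj h ->
  V \in vert G -> x \in V ->
  (in_virtual_edge h /\ V = cedge x) \/
  (~~ in_virtual_edge h /\
    exists v, [/\ v \in vert (side b), h \in v & V = restr (inj_set v)]).
Proof.
move=> xh /comp_vertP[[c [v [vG dis ->]]]|[p [pg vp ->]]].
  rewrite inE xh => hv; right; move: dis.
  case: (eqVneq c b) => [ecb|neq].
    case: _ / ecb in h xh hv *; rewrite mem_inj_set in hv.
    by rewrite (vert_undeleted vG hv) => nv; split=> //; exists v.
  have ecb : b = ~~ c by case: b c {v vG hv xh h} neq => -[].
  by move: h xh hv; rewrite ecb => h xh; rewrite mem_inj_setN.
rewrite (restr_graft_edge b) // (in_glued xh) ?mem_edges // => hp; left.
rewrite (virtual_mem _ hp) // virtE (cedge_glued xh) (edge_mem _ hp) //.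
by split=> //; case/andP: vp; case: (b).
Qed.

Lemma comp_vert_real b v h : v \in vert (side b) -> h \in v ->
  ~~ in_virtual_edge h ->
  restr (inj_set v) \in vert G /\ inj h \notin deleted.
Proof.
move=> vG hv; rewrite -(vert_undeleted vG hv) => dis; split.
  by apply/comp_vertP; left; exists b, v.
by rewrite (disjointFr dis) // mem_inj_set.
Qed.

Lemma comp_vert_ex x : exists2 V, V \in vert G & x \in V.
Proof.
have [b [h xh]] := val_ex x.
have [vh|nv] := boolP (in_virtual_edge h); last first.
  have [v vG hv] := vert_ex (planar_side b) h.
  exists (restr (inj_set v)); first exact: (comp_vert_real vG hv nv).1.
  by rewrite inE xh mem_inj_set.
have [p pg hp] := virtual_graft vh.
have vb : virt b p by rewrite -virtE -(virtual_mem _ hp).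
have vnb : virt (~~ b) p.
  have := valP x; rewrite xh mem_deleted => /exists_inPn/(_ p pg).
  by rewrite hp vb /= negb_or negbK => /andP[].
exists (restr (graft_edge p)); last by rewrite (restr_graft_edge b) // (in_glued xh)
  ?mem_edges.
apply/comp_vertP; right; exists p; split=> //.
by move: vb vnb; case: (b) => /= -> ->.
Qed.

Lemma comp_partition : partition (vert G) [set: G].
Proof.
apply/and3P; split.
- apply/eqP/setP=> x; rewrite inE; apply/bigcupP.
  by have [V] := comp_vert_ex x; exists V.
- apply/trivIsetP => V W VG WG; apply: contraR => /pred0Pn[x /andP[xV xW]].
  have [b [h xh]] := val_ex x.
  have [[vh ->]|[nv [v [vG hv ->]]]] := comp_vert_of xh VG xV;
  have [[wh ->]|[nw [w [wG hw ->]]]] := comp_vert_of xh WG xW => //.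
  - by rewrite vh in nw.
  - by rewrite wh in nv.
  - by rewrite (vert_eq _ vG wG hv hw).
apply/negP => /comp_vertP[[b [v [vG dis]]]|[p [pg _]]].
  have [h hv] := vert_has_mem (planar_side b) vG.
  move: dis; rewrite (vert_undeleted vG hv) => nv.
  have [_ hd] := comp_vert_real vG hv nv.
  by move/setP/(_ (Sub (inj h) hd)); rewrite !inE SubK mem_inj_set hv.
have [x] := glued_ex (mem_edges (leg_of true p)).
by rewrite (restr_graft_edge true) // => + e; rewrite -e inE.
Qed.

Lemma cedge_comp_sigma (x : comp_half) : cedge (comp_sigma x) = cedge x.
Proof.
have [b [h xh]] := val_ex x.
rewrite (cedge_glued xh); apply/esym/glued_cedge; rewrite ?mem_edges //.
by rewrite -(cedge_glued xh) !inE eqxx orbT.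
Qed.

Lemma comp_sigmaK : involutive (@sigma G).
Proof.
move=> x; have : x \in cedge (comp_sigma x) by rewrite cedge_comp_sigma edge_self.
rewrite in_edge => /orP[/eqP|/eqP //]; rewrite [sigma x]/(comp_sigma x) => e.
exact: etrans (congr1 (@comp_sigma G1 G2) (esym e)) (esym e).
Qed.

Lemma in_cedge_same b (h h' : side b) (x y : comp_half) :
  val x = inj h -> val y = inj h' -> (y \in cedge x) = (h' \in edge h).
Proof.
by move=> xh yh'; rewrite (cedge_glued xh) (in_glued yh') ?mem_edges.
Qed.

Lemma comp_is_graph : is_graph G.
Proof.
split; [exact: comp_partition | exact: comp_sigmaK |].
move=> V x VG neq /subsetP sub; have [b [h xh]] := val_ex x.
have xV : x \in V by apply: sub; apply: edge_self.
have [[_ //]|[nv [v [vG hv e]]]] := comp_vert_of xh VG xV.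
have : sigma x \in V by apply: sub; rewrite in_edge eqxx orbT.
rewrite e inE => /imsetP[h' h'v sh'].
have : sigma x \in cedge x by rewrite in_edge eqxx orbT.
rewrite (in_cedge_same xh sh') => h'h.
have h'neq : h' != h.
  apply: contraNneq neq => h'E; apply/eqP/val_inj.
  by rewrite sh' xh h'E.
by have [_ vh] := loop_virtual (planar_side b) vG hv h'v h'h h'neq; rewrite vh in nv.
Qed.

Lemma comp_sgnE b (h : side b) (x : comp_half) : val x = inj h ->
  @sgn G x = (b == sgn h).
Proof. by move=> xh; rewrite [LHS]/= /comp_sgn xh; case: b h xh => h xh /=;
  case: sgn. Qed.

(** The surviving half-edge is the outgoing leg itself when it is real, and the
   other, incoming, half-edge of its edge when it is virtual. *)
Lemma sgn_grafted b (h : side b) p : p \in grafts ->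
  h \in edge (leg_of b p) -> inj h \notin deleted -> sgn h = virt b p.
Proof.
move=> pg hp hd; have : inj h \in graft_edge p by rewrite mem_graft_edge_kept // hp.
rewrite mem_graft_edge // hp /=.
have := leg_of_out b pg; rewrite inE => /andP[_ sp].
have [[_ ori _] _] := planar_side b.
move: hp; rewrite in_edge; have := leg_sigma b pg.
case: virt => /= [nsp /orP[/eqP-> /andP[]|/eqP-> _]|/eqP-> /orP[]/eqP-> _].
- by rewrite eqxx.
- by have := ori _ (negbT nsp); rewrite (negbTE sp); case: sgn.
- exact: negbTE.
- exact: negbTE.
Qed.

Lemma comp_is_orientation : is_orientation G.
Proof.
move=> x neq; have [b [h xh]] := val_ex x.
have : sigma x \in cedge x by rewrite in_edge eqxx orbT.
have [c [k xk]] := val_ex (@sigma G x).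
rewrite (comp_sgnE xh) (comp_sgnE xk).
case: (eqVneq c b) => [ecb|cneq].
  case: _ / ecb in h xh *; rewrite (in_cedge_same xh xk) in_edge.
  case/orP=> [/eqP kh|/eqP kh]; subst k.
    by case/eqP: neq; apply/val_inj; rewrite xh -xk.
  have [[_ ori _] _] := planar_side c.
  have /ori : sigma h != h.
    by apply: contraNneq neq => e; apply/eqP/val_inj; rewrite xh -[in RHS]e -xk.
  by case: sgn; case: sgn => //= _; case: (c).
have ecb : c = ~~ b by case: b c {h xh k xk} cneq => -[].
move: k xk; rewrite ecb => k xk; rewrite (cedge_glued xh) (in_glued_other _ xk).
move=> /exists_inP[p pg /andP[/eqP hp kp]].
have hd := valP x; have kd := valP (comp_sigma x); rewrite xh in hd; rewrite xk in kd.
have hp' : h \in edge (leg_of b p) by rewrite hp edge_self.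
have := mem_graft_edge h pg; have := mem_graft_edge k pg.
rewrite !mem_graft_edge_kept // hd kd hp' kp /= negbK.
move=> ek eh; have {ek} vkh : virt (~~ b) p ==> virt b p.
  by move: ek; case: virt => //= /esym/andP[].
have {eh} vhk : virt b p ==> virt (~~ b) p.
  by move: eh; case: virt => //= /esym/andP[].
rewrite (sgn_grafted pg hp' hd) (sgn_grafted pg kp kd).
by case: (virt b p) vkh vhk; case: (virt (~~ b) p) => // _ _; case: (b).
Qed.

Lemma comp_directed : directed G.
Proof.
move=> V /comp_vertP[[b [v [vG dis ->]]]|[p [pg /andP[v1 v2] ->]]].
  have [[_ _ dir] _] := planar_side b.
  have [/set0Pn[h hI] /set0Pn[k kO]] := dir v vG.
  move: hI kO; rewrite !inE => /andP[hv sh] /andP[kv sk].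
  have lift l : l \in v -> exists2 x, x \in restr (inj_set v) & @sgn G x = (b == sgn l).
    move=> lv; have nd : inj l \notin deleted by rewrite (disjointFr dis) //
      mem_inj_set.
    exists (Sub (inj l) nd); last exact: comp_sgnE.
    by rewrite inE mem_inj_set.
  have [x xv sx] := lift h hv; have [y yv sy] := lift k kv.
  rewrite sh (negbTE sk) in sx sy.
  move: (restr (inj_set v)) xv yv => W xv yv.
  by case: (b) sx sy => sx sy; split; apply/set0Pn;
    [exists x | exists y | exists y | exists x]; rewrite inE ?xv ?yv ?sx ?sy.
have lift b : exists2 x, x \in restr (graft_edge p) & @sgn G x = b.
  have vb : virt b p by case: b.
  have vnb : virt (~~ b) p by case: b vb.
  have slp : sigma (leg_of b p) \in edge (leg_of b p) by rewrite in_edge eqxx orbT.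
  have kept : inj (sigma (leg_of b p)) \in graft_edge p.
    by rewrite mem_graft_edge // slp vnb leg_sigma // vb.
  have := kept; rewrite mem_graft_edge_kept // => /andP[_ nd].
  exists (Sub (inj (sigma (leg_of b p))) nd); first by rewrite inE.
  rewrite (comp_sgnE (SubK _ _)) (sgn_grafted pg slp nd) vb.
  by case: (b).
have [x xv sx] := lift true; have [y yv sy] := lift false.
by split; apply/set0Pn; [exists x | exists y]; rewrite inE ?xv ?yv ?sx ?sy.
Qed.

(** * Paths of the composition *)

(** Relations of the second graph are traversed backwards in its opposite:
   [orient b] translates between a relation of the composition and the point of
   view of the side [b]. *)
Definition orient (T : Type) (b : bool) (r : rel T) : rel T :=
  fun x y => if b then r x y else r y x.

Lemma orientN (T : Type) b (r : rel T) x y : orient (~~ b) r x y = orient b r y x.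
Proof. by case: b. Qed.

Notation creach := (@reach G).
Notation cstep := (@edge_step G).

(** A step at a real vertex comes from one of the two graphs, and a step at a
   virtual vertex stays at the same edge. *)
Lemma cstep_cases e e' : cstep e e' -> e = e' \/
  exists b (a a' : {set side b}), [/\ a \in edges (side b), a' \in edges (side b),
    e = glued a, e' = glued a' & orient b (@edge_step (side b)) a a'].
Proof.
case/edge_stepP=> [|V [x [y [[VG xV yV sx sy] [-> ->]]]]]; first exact: comp_sigmaK.
have [b [h xh]] := val_ex x.
have [[vh VE]|[nv [v [vG hv VE]]]] := comp_vert_of xh VG xV.
  left; apply/esym/edge_mem; first exact: comp_sigmaK.
  by rewrite -VE.
move: yV; rewrite VE inE => /imsetP[k kv yk].
right; exists b, (edge h), (edge k);
  rewrite !mem_edges (cedge_glued xh) (cedge_glued yk); split=> //.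
move: sx sy; rewrite (comp_sgnE xh) (comp_sgnE yk).
case: b h k xh v vG hv nv VE kv yk => h k xh v vG hv nv VE kv yk /=;
  rewrite /orient => sh sk.
  by apply/(edge_stepP (@sigma_side true)); exists v, h, k; do !split.
apply/(edge_stepP (@sigma_side false)); exists v, k, h; do !split=> //=.
by move: sh sk; do 2!case: sgn.
Qed.

Lemma orient_reach0 b e : orient b creach e e.
Proof. by case: b; apply: connect0. Qed.

Lemma orient_reach_trans b e1 e2 e3 :
  orient b creach e1 e2 -> orient b creach e2 e3 -> orient b creach e1 e3.
Proof.
by case: b => r1 r2; [apply: connect_trans r1 r2 | apply: connect_trans r2 r1].
Qed.

(** The conclusion is a path and not a step because a virtual vertex, around which
   [a = a'], may be deleted. *)
Lemma glued_step b (a a' : {set side b}) : edge_step a a' ->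
  orient b creach (glued a) (glued a').
Proof.
case/(edge_stepP (@sigma_side b))=> [v [h [k [[vG hv kv sh sk] [-> ->]]]]].
have [vh|nv] := boolP (in_virtual_edge h).
  have -> : edge k = edge h.
    by apply: edge_mem => //; rewrite -(virtual_vert _ vG hv).
  exact: orient_reach0.
have [VG hd] := comp_vert_real vG hv nv.
have nvk : ~~ in_virtual_edge k.
  rewrite -(vert_undeleted vG kv) (vert_undeleted vG hv) //.
have [_ kd] := comp_vert_real vG kv nvk.
set x : comp_half := Sub (inj h) hd; set y : comp_half := Sub (inj k) kd.
have sx : @sgn G x = (b == sgn h) by apply: comp_sgnE.
have sy : @sgn G y = (b == sgn k) by apply: comp_sgnE.
have xV : x \in restr (inj_set v) by rewrite inE mem_inj_set.
have yV : y \in restr (inj_set v) by rewrite inE mem_inj_set.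
rewrite -(@cedge_glued _ _ x) // -(@cedge_glued _ _ y) //.
rewrite sh (negbTE sk) in sx sy.
move: (restr (inj_set v)) VG xV yV => V VG xV yV.
rewrite /orient; case: (b) sx sy => sx sy; apply: connect1;
  apply/(edge_stepP comp_sigmaK).
  by exists V, x, y; do !split=> //; apply/negbT.
by exists V, y, x; do !split=> //; apply/negbT.
Qed.

Lemma glued_reach b (a a' : {set side b}) : reach a a' ->
  orient b creach (glued a) (glued a').
Proof.
move=> /connectP[p]; elim: p a => [a _ ->|c p IHp a /= /andP[st pth] lst].
  exact: orient_reach0.
exact: orient_reach_trans (glued_step st) (IHp _ pth lst).
Qed.

Lemma reach_through b (a : {set side b}) (c : {set side (~~ b)}) p : p \in grafts ->
  reach a (edge (leg_of b p)) -> reach c (edge (leg_of (~~ b) p)) ->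
  orient b creach (glued a) (glued c).
Proof.
move=> pg /glued_reach ra /glued_reach; rewrite (glued_graft (~~ b) b) // => rc.
by apply: orient_reach_trans ra _; rewrite -orientN.
Qed.

(** A path of the composition stays in one graph or passes once from the first
   to the second, through a grafted edge.  It cannot come back: entering the
   first graph from the second would happen at an outgoing leg of the first,
   and nothing leaves such a leg. *)
Lemma creach_cases e e' : e' \in edges G -> creach e e' ->
  (exists b (a a' : {set side b}), [/\ a \in edges (side b), a' \in edges (side b),
     e = glued a, e' = glued a' & orient b (@reach (side b)) a a']) \/
  (exists (a : {set side true}) (c : {set side false}) p,
     [/\ a \in edges (side true), c \in edges (side false), e = glued a &
       e' = glued c] /\
     [/\ p \in grafts, reach a (edge (leg_of true p)) &
       reach c (edge (leg_of false p))]).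
Proof.
move=> e'E /connectP[s]; elim: s e => [e _ /= <-|e1 s IHs e /= /andP[st pth] lst].
  have [b [a [aE ->]]] := cedges_glued e'E; left; exists b, a, a; split=> //.
  by rewrite /orient if_same; apply: connect0.
(* In the second graph nothing enters an incoming leg, so a step to a grafted
   edge can only start at this edge. *)
have stuck p (d : {set side false}) : p \in grafts ->
    edge_step (edge (leg_of false p)) d -> d = edge (leg_of false p).
  move=> pg st1; apply: (out_leg_reach (planar_side false)); first exact: leg_of_out.
  exact: connect1.
have [->|[b [d [d1 [dE d1E -> e1E sd]]]]] := cstep_cases st; first exact: IHs.
have [[c [a [a' [aE a'E e1E' e'_a' ra]]]]|] := IHs _ pth lst; last first.
  move=> [a [c [p [[aE cE e1E' e'c] [pg ra rc]]]]]; right;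
    case: b d d1 dE d1E e1E sd => d d1 dE d1E e1E sd.
    exists d, c, p; do !split=> //; apply: connect_trans (connect1 sd) _.
    by rewrite (glued_inj d1E aE) // -e1E.
  exists a, c, p; do !split=> //; rewrite -e1E' e1E.
  have [q qg [eq ed]] := @glued_eq_other true _ _ aE d1E (etrans (esym e1E') e1E).
  by move: sd; rewrite /orient ed => /(stuck _ _ qg) ->.
case: b d d1 dE d1E e1E sd => d d1 dE d1E e1E sd;
case: c a a' aE a'E e1E' e'_a' ra => a a' aE a'E e1E' e'_a' ra.
- left; exists true, d, a'; split=> //; apply: connect_trans (connect1 sd) _.
  by rewrite (glued_inj d1E aE) // -e1E.
- right; have [p pg [d1p ap]] := @glued_eq_other true _ _ d1E aE (etrans (esym e1E)
    e1E').
  exists d, a', p; do !split=> //; last by rewrite -ap.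
  by rewrite -d1p; apply: connect1.
- left; exists true, a, a'; split=> //; rewrite -e1E' e1E.
  have [q qg [_ ed]] := @glued_eq_other true _ _ aE d1E (etrans (esym e1E') e1E).
  by move: sd; rewrite /orient ed => /(stuck _ _ qg) ->.
left; exists false, d, a'; split=> //; apply: connect_trans ra (connect1 _).
by rewrite (glued_inj aE d1E) // -e1E'.
Qed.

(** * The order of the composition *)

Notation O k := (nth set0 (out_edges G1) k).
Notation I k := (nth set0 (in_edges G2) k).
Notation glued1 := (@glued true).
Notation glued2 := (@glued false).

Lemma nth_out_edges p k : k < n -> O k = edge (leg_of true (nth p grafts k)).
Proof. by move=> kn; rewrite (nth_map p.1) ?size_outs // grafts_nth. Qed.

Lemma nth_in_edges p k : k < n -> I k = edge (leg_of false (nth p grafts k)).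
Proof. by move=> kn; rewrite (nth_map p.2) ?size_ins // grafts_nth. Qed.

Lemma graft_inhab k : k < n -> {p | p \in grafts}.
Proof. by rewrite /n; case: grafts => // p s _; exists p; rewrite inE eqxx. Qed.

Lemma out_edgesE k : k < n -> O k \in edges G1.
Proof.
by move=> kn; have [p _] := graft_inhab kn; rewrite (nth_out_edges p) ?mem_edges.
Qed.

Lemma in_edgesE k : k < n -> I k \in edges G2.
Proof.
by move=> kn; have [p _] := graft_inhab kn; rewrite (nth_in_edges p) // (@mem_edges G2).
Qed.

Lemma out_edges_prec k l : k < l -> l < n -> prec (O k) (O l).
Proof.
move=> kl ln; have [p _] := graft_inhab ln.
rewrite !(nth_out_edges p) // ?(ltn_trans kl) //.
exact: (@graft_nth_prec true).
Qed.

Lemma in_edges_prec k l : k < l -> l < n -> prec (I k) (I l).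
Proof.
move=> kl ln; have [p _] := graft_inhab ln.
rewrite !(nth_in_edges p) // ?(ltn_trans kl) //.
exact: (@graft_nth_prec false).
Qed.

Lemma out_edges_le k l : k <= l -> l < n -> preceq (O k) (O l).
Proof.
rewrite leq_eqVlt => /predU1P[->|kl ln]; first by rewrite /preceq eqxx.
by rewrite /preceq out_edges_prec ?orbT.
Qed.

Lemma in_edges_le k l : k <= l -> l < n -> preceq (I k) (I l).
Proof.
rewrite leq_eqVlt => /predU1P[->|kl ln]; first by rewrite /preceq eqxx.
by rewrite /preceq in_edges_prec ?orbT.
Qed.

Lemma glued_out_in k : k < n -> glued1 (O k) = glued2 (I k).
Proof.
move=> kn; have [p _] := graft_inhab kn.
by rewrite (nth_out_edges p) // (nth_in_edges p) // (glued_graft true false) // mem_nth.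
Qed.

Lemma grafted_index b p : p \in grafts -> exists2 k, k < n &
  edge (leg_of b p) = (if b return {set side b} then O k else I k).
Proof.
move=> /graft_ex[k kn e]; exists k => //; rewrite {1}e.
by case: b; rewrite ?(nth_out_edges p) // (nth_in_edges p).
Qed.

(** The grafted edge of a block is counted with both graphs: as the last edge
   coming from the first and as the first edge coming from the second.  So the
   [blockA k] cover the edges of [G1] and the [blockB k] those of [G2]. *)
Definition blockA k : seq {set G1} := rcons (seqA G1 k) (O k).
Definition blockB k : seq {set G2} := I k :: seqB G2 k.
Definition block k : seq {set comp_half} :=
  [seq glued1 a | a <- blockA k] ++ [seq glued2 b | b <- seqB G2 k].

Lemma size_in_edges : size (in_edges G2) = n.
Proof. by rewrite size_map size_ins. Qed.

Lemma mem_seqA k a : (a \in seqA G1 k) =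
  [&& a \in edges G1, (k == 0) || prec (O k.-1) a & prec a (O k)].
Proof. by rewrite mem_filter edge_seqP andbC andbA. Qed.

Lemma mem_seqB k b : (b \in seqB G2 k) =
  [&& b \in edges G2, prec (I k) b & (k.+1 == n) || prec b (I k.+1)].
Proof. by rewrite mem_filter edge_seqP size_in_edges andbC andbA. Qed.

Lemma mem_blockA k a : k < n -> (a \in blockA k) =
  [&& a \in edges G1, (k == 0) || prec (O k.-1) a & preceq a (O k)].
Proof.
move=> kn; rewrite mem_rcons inE mem_seqA /preceq; case: eqVneq => [->|//].
rewrite out_edgesE //= andbT; case: k kn => // k kn /=.
by rewrite out_edges_prec.
Qed.

Lemma mem_blockB k b : k < n -> (b \in blockB k) =
  [&& b \in edges G2, preceq (I k) b & (k.+1 == n) || prec b (I k.+1)].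
Proof.
move=> kn; rewrite inE mem_seqB /preceq eq_sym; case: eqVneq => [<-|//].
rewrite in_edgesE //=; case: eqVneq => //= neq.
by rewrite in_edges_prec // ltn_neqAle neq.
Qed.

Lemma seqA_nongraft k a l : k < n -> l < n -> a \in seqA G1 k -> a <> O l.
Proof.
move=> kn ln; rewrite mem_seqA => /and3P[_ lo hi] e; rewrite {}e in lo hi.
have [kl|lk] := leqP k l.
  have := le_prec_trans pl1 (out_edgesE kn) (out_edgesE ln) (out_edgesE kn)
    (out_edges_le kl ln) hi.
  by rewrite prec_irr ?out_edgesE.
case: k kn lo hi lk => // k kn /= lo _ lk.
have kn' := ltnW kn; have lk' : l <= k := lk.
have := prec_le_trans pl1 (out_edgesE kn') (out_edgesE ln) (out_edgesE kn') lo
  (out_edges_le lk' kn').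
by rewrite prec_irr ?out_edgesE.
Qed.

Lemma seqB_nongraft k b l : k < n -> l < n -> b \in seqB G2 k -> b <> I l.
Proof.
move=> kn ln; rewrite mem_seqB => /and3P[_ lo hi] e; rewrite {}e in lo hi.
have [lk|kl] := leqP l k.
  have := prec_le_trans pl2 (in_edgesE kn) (in_edgesE ln) (in_edgesE kn) lo
    (in_edges_le lk kn).
  by rewrite prec_irr ?in_edgesE.
case/orP: hi => [/eqP e|hi]; first by rewrite -e ltnNge kl in ln.
have k1n := leq_ltn_trans kl ln.
have := le_prec_trans pl2 (in_edgesE k1n) (in_edgesE ln) (in_edgesE k1n) (in_edges_le
  kl ln) hi.
by rewrite prec_irr ?in_edgesE.
Qed.

Lemma glued_nongraft b (a : {set side b}) : a \in edges (side b) ->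
  (forall p, p \in grafts -> edge (leg_of b p) != a) -> glued a = restr (inj_set a).
Proof.
move=> aE nog; apply/setP=> x; rewrite 2!inE.
have -> : [exists p in grafts, (edge (leg_of b p) == a) &&
    [exists h in edge (leg_of (~~ b) p), inj h == val x]] = false.
  by apply/exists_inP => -[p /nog/negbTE->].
rewrite orbF; apply/exists_inP/imsetP => [[h ha /eqP <-]|[h ha ->]]; by exists h.
Qed.

Lemma glued_seqA k a : k < n -> a \in seqA G1 k -> restr (inl_set G2 a) = glued1 a.
Proof.
move=> kn aA; rewrite glued_nongraft //; first by move: aA; rewrite mem_seqA => /andP[].
move=> p /(grafted_index true)[l ln ->]; apply/eqP => e.
exact: seqA_nongraft kn ln aA (esym e).
Qed.

Lemma glued_seqB k b : k < n -> b \in seqB G2 k -> restr (inr_set G1 b) = glued2 b.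
Proof.
move=> kn bB; rewrite glued_nongraft //; first by move: bB; rewrite mem_seqB => /andP[].
move=> p /(grafted_index false)[l ln ->]; apply/eqP => e.
exact: seqB_nongraft kn ln bB (esym e).
Qed.

Lemma comp_edge_seqE :
  comp_edge_seq G1 G2 = flatten [seq block k | k <- iota 0 n].
Proof.
congr flatten; apply/eq_in_map => k; rewrite mem_iota /= add0n => kn.
rewrite /block /blockA map_rcons cat_rcons; congr (_ ++ _ :: _).
- by apply/eq_in_map => a; apply: glued_seqA.
- have [p _] := graft_inhab kn.
  by rewrite (nth_map p) // (nth_out_edges p) // (restr_graft_edge true) // mem_nth.
by apply/eq_in_map => b; apply: glued_seqB.
Qed.

Lemma blockE k : k < n ->
  block k = [seq glued1 a | a <- seqA G1 k] ++ [seq glued2 b | b <- blockB k].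
Proof. by move=> kn; rewrite /block /blockA map_rcons cat_rcons glued_out_in. Qed.

(** By [reach_out_leg] some outgoing leg comes at or after [a]; the first such
   leg closes the block of [a]. *)
Lemma blockA_ex a : a \in edges G1 -> exists2 k, k < n & a \in blockA k.
Proof.
move=> aE; have [o oG /(reach_prec pl1) le] := reach_out_leg pl1 aE.
have exk : exists k, (k < n) && preceq a (O k).
  have [p pg e] := @out_leg_of true o oG; have [k kn ek] := grafted_index true pg.
  by exists k; rewrite kn -ek e le // mem_edges.
case: (ex_minnP exk) => k /andP[kn ak] mink; exists k => //.
rewrite mem_blockA // aE ak andbT; case: k kn ak mink => //= k kn _ mink.
rewrite -preceqN ?out_edgesE // 1?ltnW //; apply/negP => le'.
by have := mink k; rewrite le' (ltnW kn) ltnn => /(_ isT).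
Qed.

Lemma blockB_ex b : b \in edges G2 -> exists2 k, k < n & b \in blockB k.
Proof.
move=> bE; have [o oG /(reach_prec (planar_op pl2)) le] :=
  reach_out_leg (planar_op pl2) bE.
have exk : exists k, (k < n) && preceq (I k) b.
  have [p pg e] := @out_leg_of false o oG; have [k kn ek] := grafted_index false pg.
  by exists k; rewrite kn -ek e -preceq_op le // mem_edges.
have ub k : (k < n) && preceq (I k) b -> k <= n by case/andP=> /ltnW.
case: (ex_maxnP exk ub) => k /andP[kn kb] maxk; exists k => //.
rewrite mem_blockB // bE kb /=; case: eqVneq => //= neq.
have kn1 : k.+1 < n by rewrite ltn_neqAle neq.
rewrite -preceqN ?in_edgesE //; apply/negP => le'.
by have := maxk k.+1; rewrite le' kn1 ltnn => /(_ isT).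
Qed.

Lemma blockA_le k l a a' : k < n -> l < n -> a \in blockA k -> a' \in blockA l ->
  preceq a a' -> k <= l.
Proof.
move=> kn ln; rewrite !mem_blockA // => /and3P[aE lo _] /and3P[a'E _ hi] aa'.
rewrite leqNgt; apply/negP => lk; case: k kn lo lk => // k kn /= lo lk.
have kE : O k \in edges G1 by rewrite out_edgesE // ltnW.
have lE : O l \in edges G1 by rewrite out_edgesE.
have le := preceq_trans pl1 aE a'E lE aa' hi.
have le' := preceq_trans pl1 aE lE kE le (out_edges_le (lk : l <= k) (ltnW kn)).
by have := preceqNgt pl1 aE kE; rewrite le' lo.
Qed.

Lemma blockB_le k l b b' : k < n -> l < n -> b \in blockB k -> b' \in blockB l ->
  preceq b b' -> k <= l.
Proof.
move=> kn ln; rewrite !mem_blockB // => /and3P[bE lo _] /and3P[b'E _ hi] bb'.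
rewrite leqNgt; apply/negP => lk.
have l1n : l.+1 < n by apply: leq_ltn_trans kn.
rewrite (ltn_eqF l1n) /= in hi.
have kE : I k \in edges G2 by rewrite in_edgesE.
have lE : I l.+1 \in edges G2 by rewrite in_edgesE.
have le := preceq_trans pl2 lE kE bE (in_edges_le lk kn) lo.
have le' := preceq_trans pl2 lE bE b'E le bb'.
by have := preceqNgt pl2 lE b'E; rewrite le' hi.
Qed.

Lemma mem_block_glued1 k a : k < n -> a \in edges G1 ->
  (glued1 a \in block k) = (a \in blockA k).
Proof.
move=> kn aE; apply/idP/idP => [|aA]; last by rewrite mem_cat map_f.
rewrite mem_cat => /orP[/mapP[a' a'A]|/mapP[b bB e]].
  have a'E : a' \in edges G1 by move: a'A; rewrite mem_blockA // => /andP[].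
  by move/(glued_inj (b := true) aE a'E) => ->.
have bE : b \in edges G2 by move: bB; rewrite mem_seqB => /andP[].
have [p pg [_ bp]] := @glued_eq_other true _ _ aE bE e.
have [l ln el] := grafted_index false pg.
by case: (seqB_nongraft kn ln bB); rewrite bp -el.
Qed.

Lemma mem_block_glued2 k b : k < n -> b \in edges G2 ->
  (glued2 b \in block k) = (b \in blockB k).
Proof.
move=> kn bE; rewrite blockE //; apply/idP/idP => [|aA];
  last by rewrite mem_cat orbC map_f.
rewrite mem_cat => /orP[/mapP[a aA e]|/mapP[b' b'B]].
  have aE : a \in edges G1 by move: aA; rewrite mem_seqA => /andP[].
  have [p pg [ap _]] := @glued_eq_other true _ _ aE bE (esym e).
  have [l ln el] := grafted_index true pg.
  by case: (seqA_nongraft kn ln aA); rewrite ap -el.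
have b'E : b' \in edges G2 by move: b'B; rewrite mem_blockB // => /andP[].
by move/(glued_inj (b := false) bE b'E) => ->.
Qed.

Lemma block_glued k e : k < n -> e \in block k ->
  (exists2 a, a \in blockA k & e = glued1 a) \/ (exists2 b, b \in blockB k &
    e = glued2 b).
Proof.
move=> kn; rewrite mem_cat => /orP[]/mapP[d dk ->]; [left|right]; exists d => //.
by rewrite inE dk orbT.
Qed.

Lemma block_uniq k l e : k < n -> l < n -> e \in block k -> e \in block l -> k = l.
Proof.
move=> kn ln ek el; have [[a ak e_a]|[b bk e_b]] := block_glued kn ek.
  have aE : a \in edges G1 by move: ak; rewrite mem_blockA // => /andP[].
  rewrite e_a mem_block_glued1 // in el.
  have aa : preceq a a by rewrite /preceq eqxx.
  by apply/eqP; rewrite eqn_leq (blockA_le kn ln ak el) // (blockA_le ln kn el ak).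
have bE : b \in edges G2 by move: bk; rewrite mem_blockB // => /andP[].
rewrite e_b mem_block_glued2 // in el.
have bb : preceq b b by rewrite /preceq eqxx.
by apply/eqP; rewrite eqn_leq (blockB_le kn ln bk el) // (blockB_le ln kn el bk).
Qed.

Notation cprec := (@comp_prec G1 G2).

Lemma mem_block_seq k e : k < n -> e \in block k -> e \in comp_edge_seq G1 G2.
Proof.
move=> kn ek; rewrite comp_edge_seqE; apply/flatten_mapP; exists k => //.
by rewrite mem_iota.
Qed.

Lemma mem_earlier_blocks k l e : k <= l -> l < n -> e \in block l ->
  (e \in flatten [seq block i | i <- iota 0 k]) = false.
Proof.
move=> kl ln el; apply/flatten_mapP => -[i]; rewrite mem_iota /= => ik ei.
have il : i < l by apply: leq_trans kl.
by have := block_uniq (ltn_trans il ln) ln ei el; apply/eqP; rewrite (ltn_eqF il).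
Qed.

Lemma comp_prec_blocks k l e e' : k < l -> l < n -> e \in block k -> e' \in block l ->
  cprec e e'.
Proof.
move=> kl ln ek e'l; rewrite /comp_prec (mem_block_seq ln e'l) comp_edge_seqE /=.
rewrite -(subnKC (ltnW ln)) iotaD map_cat flatten_cat !index_cat.
rewrite (mem_earlier_blocks (leqnn l) ln e'l); case: ifP => [|/negP[]].
  by rewrite -index_mem => /leq_trans-> //; apply: leq_addr.
by apply/flatten_mapP; exists k; rewrite // mem_iota.
Qed.

Lemma comp_prec_block k e e' : k < n -> e \in block k -> e' \in block k ->
  index e (block k) < index e' (block k) -> cprec e e'.
Proof.
move=> kn ek e'k lt; rewrite /comp_prec (mem_block_seq kn e'k) comp_edge_seqE /=.
have -> : iota 0 n = iota 0 k ++ k :: iota k.+1 (n - k.+1).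
  by rewrite -{1}(subnKC (ltnW kn)) iotaD add0n -(subnSK kn).
rewrite map_cat flatten_cat map_cons.
have idx x : x \in block k -> forall s, index x (flatten [seq block i | i <- iota 0 k]
    ++ flatten (block k :: s)) = size (flatten [seq block i | i <- iota 0 k]) +
      index x (block k).
  move=> xk s; rewrite index_cat (mem_earlier_blocks (leqnn k) kn xk).
  by rewrite [flatten (_ :: _)]/(block k ++ flatten s) index_cat xk.
by rewrite !idx // ltn_add2l.
Qed.

Lemma glued1_mono a a' : a \in edges G1 -> a' \in edges G1 -> prec a a' ->
  cprec (glued1 a) (glued1 a').
Proof.
move=> aE a'E aa'; have [k kn ak] := blockA_ex aE; have [l ln a'l] := blockA_ex a'E.
have le : preceq a a' by rewrite /preceq aa' orbT.
have := blockA_le kn ln ak a'l le; rewrite leq_eqVlt => /predU1P[ekl|kl]; last first.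
  by apply: (comp_prec_blocks kl ln); rewrite mem_block_glued1.
subst l; apply: (comp_prec_block kn); rewrite ?mem_block_glued1 //.
rewrite /block !index_cat !map_f //.
apply: (@index_map_pairwise _ _ _ (@preceq G1)) => //.
- move=> d d'; rewrite !mem_blockA // => /andP[dE _] /andP[d'E _].
  exact: (glued_inj (b := true)).
- rewrite /blockA pairwise_rcons pairwise_filter ?pairwise_edge_seq // andbT.
  by apply/allP=> d; rewrite mem_seqA /preceq => /and3P[_ _ ->]; rewrite orbT.
- by rewrite preceqN.
by apply: contraTneq aa' => ->; rewrite prec_irr.
Qed.

Lemma glued2_mono b b' : b \in edges G2 -> b' \in edges G2 -> prec b b' ->
  cprec (glued2 b) (glued2 b').
Proof.
move=> bE b'E bb'; have [k kn bk] := blockB_ex bE; have [l ln b'l] := blockB_ex b'E.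
have le : preceq b b' by rewrite /preceq bb' orbT.
have := blockB_le kn ln bk b'l le; rewrite leq_eqVlt => /predU1P[ekl|kl]; last first.
  by apply: (comp_prec_blocks kl ln); rewrite mem_block_glued2.
subst l; apply: (comp_prec_block kn); rewrite ?mem_block_glued2 //.
have notA d : d \in edges G2 -> (glued2 d \in [seq glued1 a | a <- seqA G1 k]) = false.
  move=> dE; apply/mapP => -[a aA e].
  have aE : a \in edges G1 by move: aA; rewrite mem_seqA => /andP[].
  have [p pg [ap _]] := @glued_eq_other true _ _ aE dE (esym e).
  have [l ln' el] := grafted_index true pg.
  by case: (seqA_nongraft kn ln' aA); rewrite ap -el.
rewrite blockE // !index_cat !notA // ltn_add2l.
apply: (@index_map_pairwise _ _ _ (@preceq G2)) => //.
- move=> d d'; rewrite !mem_blockB // => /andP[dE _] /andP[d'E _].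
  exact: (glued_inj (b := false)).
- rewrite /blockB pairwise_cons pairwise_filter ?pairwise_edge_seq // andbT.
  by apply/allP=> d; rewrite mem_seqB /preceq => /and3P[_ -> _]; rewrite orbT.
- by rewrite preceqN.
by apply: contraTneq bb' => ->; rewrite prec_irr.
Qed.

Lemma cprec_irr e : cprec e e = false.
Proof. by rewrite /comp_prec ltnn andbF. Qed.

Lemma cprec_trans e e' e'' : cprec e e' -> cprec e' e'' -> cprec e e''.
Proof. by move=> /andP[_ lt] /andP[m lt']; rewrite /comp_prec m (ltn_trans lt lt'). Qed.

(** In terms of the blocks [k] of [a] and [l] of [b]: if [l < k] then [b] comes
   first, and otherwise the [l]-th graft separates the two edges. *)
Lemma glued12_cprec a b : a \in edges G1 -> b \in edges G2 ->
  cprec (glued1 a) (glued2 b) ->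
  exists p, [/\ p \in grafts, preceq a (edge (p.1)) & preceq (edge p.2) b].
Proof.
move=> aE bE ab; have [k kn ak] := blockA_ex aE; have [l ln bl] := blockB_ex bE.
have [kl|lk] := leqP k l; last first.
  have ba : cprec (glued2 b) (glued1 a).
    by apply: (comp_prec_blocks lk kn); rewrite ?mem_block_glued1 ?mem_block_glued2.
  by have := cprec_trans ab ba; rewrite cprec_irr.
have [p0 _] := graft_inhab ln; exists (nth p0 grafts l); split; first exact: mem_nth.
  have <- : O l = edge (nth p0 grafts l).1 := nth_out_edges p0 ln.
  apply: preceq_trans (out_edges_le kl ln); rewrite ?out_edgesE //.
  by move: ak; rewrite mem_blockA // => /and3P[].
have <- : I l = edge (nth p0 grafts l).2 := nth_in_edges p0 ln.
by move: bl; rewrite mem_blockB // => /and3P[].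
Qed.

Lemma glued_mono b (a a' : {set side b}) : a \in edges (side b) ->
  a' \in edges (side b) ->
  prec a a' -> orient b cprec (glued a) (glued a').
Proof.
case: b a a' => a a' aE a'E; first exact: glued1_mono.
exact: glued2_mono.
Qed.

Lemma glued_cross b (a : {set side b}) (c : {set side (~~ b)}) :
  a \in edges (side b) -> c \in edges (side (~~ b)) ->
    orient b cprec (glued a) (glued c) ->
  exists p, [/\ p \in grafts, preceq a (edge (leg_of b p)) &
    preceq c (edge (leg_of (~~ b) p))].
Proof.
case: b a c => a c aE cE ac.
  have [p [pg ap pc]] := glued12_cprec aE cE ac.
  by exists p; split=> //; rewrite preceq_op.
have [p [pg ap pc]] := glued12_cprec cE aE ac.
by exists p; split=> //; rewrite preceq_op.
Qed.

Lemma orient_cprec_trans b e e' e'' :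
  orient b cprec e e' -> orient b cprec e' e'' -> orient b cprec e e''.
Proof. by case: b => p q; [apply: cprec_trans p q | apply: cprec_trans q p]. Qed.

Lemma orient_cprec_irr b e : orient b cprec e e = false.
Proof. by case: b; apply: cprec_irr. Qed.

Lemma glued_mono_inv b (a a' : {set side b}) : a \in edges (side b) ->
  a' \in edges (side b) ->
  orient b cprec (glued a) (glued a') -> prec a a'.
Proof.
move=> aE a'E aa'; rewrite -preceqN //; apply/negP => /predU1P[e|a'a].
  by rewrite e orient_cprec_irr in aa'.
by have := orient_cprec_trans aa' (glued_mono a'E aE a'a); rewrite orient_cprec_irr.
Qed.

Lemma leg_of_preceqN b p q : p \in grafts -> q \in grafts ->
  preceq (edge (leg_of (~~ b) p)) (edge (leg_of (~~ b) q)) ->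
  preceq (edge (leg_of b q)) (edge (leg_of b p)).
Proof. by case: b => pg qg; apply: leg_of_preceq. Qed.

(** * Planarity of the composition *)

(** Axiom (P2) for a path inside one graph and an edge [c] of the other.  A graft
   separates [a1] from [c]; by [reach_out_leg_before] it can be moved towards [c]
   until [c] is connected to it.  Then it lies between [a1] and [a2], so that
   [a1] reaches it by [reach_between_out_leg]. *)
Lemma reach_other_side_between b (a1 a2 : {set side b}) (c : {set side (~~ b)}) :
  a1 \in edges (side b) -> a2 \in edges (side b) -> c \in edges (side (~~ b)) ->
  reach a1 a2 -> orient b cprec (glued a1) (glued c) ->
    orient b cprec (glued c) (glued a2) ->
  orient b creach (glued a1) (glued c).
Proof.
move=> a1E a2E cE r12 a1c ca2.
have [p [pg a1p cp]] := glued_cross a1E cE a1c.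
have [o [oG co op]] := reach_out_leg_before (planar_side _) cE (leg_of_out _ pg) cp.
have [q qg eq] := out_leg_of oG; rewrite -{}eq in co op.
have pq := leg_of_preceqN qg pg op.
have a1q := preceq_trans (planar_side b) a1E (mem_edges _) (mem_edges _) a1p pq.
have qa2 : prec (edge (leg_of b q)) a2.
  apply: glued_mono_inv; rewrite ?mem_edges // (glued_graft b (~~ b)) //.
  have [<-//|cq] := predU1P (reach_prec (planar_side _) cE (mem_edges _) co).
  have := glued_mono cE (mem_edges _) cq; rewrite orientN => qc.
  exact: orient_cprec_trans qc ca2.
apply: (reach_through qg _ co).
exact: (reach_between_out_leg (planar_side b) a1E a2E (leg_of_out b qg) r12 a1q qa2).
Qed.

(** Axiom (P2) for a path passing through the graft [p].  If [d] comes before [p],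
   axiom (P2) of its own graph applies.  Otherwise some graft [q] connected to
   [d] separates [d] from [c]; as [q] lies between [p] and [c] on the other
   side, [c] is connected to it as well. *)
Lemma reach_graft_between b (a d : {set side b}) (c : {set side (~~ b)}) p :
  a \in edges (side b) -> d \in edges (side b) -> c \in edges (side (~~ b)) ->
  p \in grafts -> reach a (edge (leg_of b p)) -> reach c (edge (leg_of (~~ b) p)) ->
  orient b cprec (glued a) (glued d) -> orient b cprec (glued d) (glued c) ->
  orient b creach (glued a) (glued d) \/ orient b creach (glued d) (glued c).
Proof.
move=> aE dE cE pg ra rc ad dc; have pE := mem_edges (leg_of b p).
have [/predU1P[->|dp]|] := boolP (preceq d (edge (leg_of b p))).
- by left; apply: glued_reach.
- have [r|r] := planar_P2 (planar_side b) aE pE dE ra (glued_mono_inv aE dE ad) dp.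
    by left; apply: glued_reach.
  by right; apply: reach_through r rc.
rewrite preceqN // => pd.
have [r [rg dr cr]] := glued_cross dE cE dc.
have [o [oG dq qr]] := reach_out_leg_before (planar_side b) dE (leg_of_out b rg) dr.
have [q qg eq] := out_leg_of oG; rewrite -{}eq in dq qr.
have pq : prec (edge (leg_of b p)) (edge (leg_of b q)).
  apply: (prec_le_trans (planar_side b) _ dE _ pd); rewrite ?mem_edges //.
  exact: (reach_prec (planar_side b) dE (mem_edges _) dq).
have cq : preceq c (edge (leg_of (~~ b) q)).
  apply: (preceq_trans (planar_side _) cE _ _ cr); rewrite ?mem_edges //.
  exact: leg_of_preceq.
right; apply: (reach_through qg dq).
exact: (reach_between_out_leg (planar_side _) cE (mem_edges _) (leg_of_out _ qg) rc cq
  (leg_of_prec pg qg pq)).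
Qed.

Lemma cedges_seq e : e \in edges G -> e \in comp_edge_seq G1 G2.
Proof.
move=> /cedges_glued[[] [a [aE ->]]].
  by have [k kn ak] := blockA_ex aE; apply: (mem_block_seq kn);
    rewrite mem_block_glued1.
by have [k kn ak] := blockB_ex aE; apply: (mem_block_seq kn); rewrite mem_block_glued2.
Qed.

Lemma comp_linear_order : is_linear_order G.
Proof.
split=> [e _|e2 e1 e3 _ _ _|e e' eE e'E]; first by rewrite /= cprec_irr.
  exact: cprec_trans.
rewrite /= /comp_prec !cedges_seq //=; case: ltngtP; rewrite ?orbT // orbF => eq_i.
by rewrite -(nth_index e (cedges_seq eE)) eq_i nth_index ?eqxx ?cedges_seq.
Qed.

Lemma comp_P1 : axiom_P1 G.
Proof.
move=> e e' eE e'E neq /(creach_cases e'E)[[b [a [a' [aE a'E ee e'e r]]]]|].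
  rewrite ee e'e in neq *; case: b a a' aE a'E r neq {ee e'e} => a a' aE a'E r neq.
    apply: glued1_mono => //; have /predU1P[e0|//] := reach_prec pl1 aE a'E r.
    by rewrite e0 eqxx in neq.
  apply: glued2_mono => //; have /predU1P[e0|//] := reach_prec (planar_op pl2) a'E aE r.
  by rewrite e0 eqxx in neq.
move=> [a [c [p [[aE cE ee e'e] [pg ra rc]]]]].
rewrite ee e'e in neq *.
have pe := glued_graft true false pg.
have /predU1P[ap|ap] := reach_prec pl1 aE (mem_edges _) ra;
have /predU1P[cp|cp] := reach_prec (planar_op pl2) cE (mem_edges _) rc.
- by rewrite ap cp pe eqxx in neq.
- by rewrite ap pe; apply: (@glued_mono false) cp; rewrite ?mem_edges.
- by rewrite cp -pe; apply: (@glued_mono true) ap; rewrite ?mem_edges.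
apply: (@cprec_trans _ (glued1 (edge (leg_of true p)))).
  by apply: (@glued_mono true) ap; rewrite ?mem_edges.
by rewrite pe; apply: (@glued_mono false) cp; rewrite ?mem_edges.
Qed.

Lemma comp_P2 : axiom_P2 G.
Proof.
move=> e1 e2 e3 e1E e2E e3E _ r12 p13 p32.
have [c [d [dE e3d]]] := cedges_glued e3E; rewrite {}e3d {e3E} in p13 p32 *.
have [[b [a [a' [aE a'E e1a e2a r]]]]|] := creach_cases e2E r12.
  rewrite {}e1a {}e2a {e1E e2E r12} in p13 p32 *.
  case: b a a' aE a'E r p13 p32 => a a' aE a'E r p13 p32;
  case: c d dE p13 p32 => d dE p13 p32.
  - have [r'|r'] := planar_P2 pl1 aE a'E dE r
      (@glued_mono_inv true _ _ aE dE p13) (@glued_mono_inv true _ _ dE a'E p32).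
      by left; apply: (@glued_reach true).
    by right; apply: (@glued_reach true).
  - by left; apply: (@reach_other_side_between true) r p13 p32.
  - by right; apply: (@reach_other_side_between false) r p32 p13.
  have [r'|r'] := planar_P2 (planar_op pl2) a'E aE dE r
      (@glued_mono_inv false _ _ a'E dE p32) (@glued_mono_inv false _ _ dE aE p13).
    by right; apply: (@glued_reach false).
  by left; apply: (@glued_reach false).
move=> [a [a' [p [[aE a'E e1a e2a] [pg ra ra']]]]].
rewrite {}e1a {}e2a {e1E e2E r12} in p13 p32 *.
case: c d dE p13 p32 => d dE p13 p32.
  exact: (@reach_graft_between true _ _ _ p).
by case: (@reach_graft_between false _ _ _ p a'E dE aE pg ra' ra p32 p13);
  [right | left].
Qed.

Lemma planar_comp : planar G.
Proof.
split; split.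
- exact: comp_is_graph.
- exact: comp_is_orientation.
- exact: comp_directed.
- exact: comp_linear_order.
- exact: comp_P1.
exact: comp_P2.
Qed.

End Composition.

Theorem theorem3p5p5 (G1 G2 : graph_data) :
  planar G1 -> planar G2 -> #|Out_G G1| = #|In_G G2| -> planar (graph_comp G2 G1).
Proof. exact: planar_comp. Qed.
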